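(* Let $\mathfrak g$ be a finite dimensional simple Lie algebra of rank $n$. Then $$\mathrm{Aut}_{\rm Hopf}\,U_q^+(\mathfrak g)\simeq(\Bbbk^\times)^n\rtimes\mathrm{Autdiagr}(\mathfrak g)\simeq\mathrm{Aut}_{\rm Hopf}\,U_q(\mathfrak b^+),$$ where the torus acts by $E_i\mapsto\alpha_iE_i$ (and $K_i\mapsto K_i$) and $\sigma\in\mathrm{Autdiagr}(\mathfrak g)$ acts by $E_i\mapsto E_{\sigma(i)}$ (and $K_i\mapsto K_{\sigma(i)}$).
   Context: $\Bbbk$ is a field of characteristic $0$ and $q\in\Bbbk^\times$ is not algebraic over $\mathbb Q$. $(a_{ij})_{1\le i,j\le n}$ is the Cartan matrix of $\mathfrak g$ and $d_1,\dots,d_n$ the relatively prime positive integers with $(d_ia_{ij})$ symmetric. $U_q^+(\mathfrak g)$ is the $\Bbbk$-algebra generated by $E_1,\dots,E_n$ with relations $\sum_{\nu=0}^{1-a_{ij}}\left[\begin{smallmatrix}1-a_{ij}\\ \nu\end{smallmatrix}\right]_{q^{d_i}}E_i^{1-a_{ij}-\nu}E_j(-E_i)^\nu=0$ for $i\neq j$ (Gaussian binomial coefficients). $U_q(\mathfrak b^+)$ is generated by $E_i,K_i^{\pm1}$ with these relations, the $K_i$ commuting invertible, and $K_iE_j=q^{d_ia_{ij}}E_jK_i$; it is a Hopf algebra with $\Delta(K_i)=K_i\otimes K_i$, $\Delta(E_i)=E_i\otimes1+K_i\otimes E_i$, $\varepsilon(K_i)=1,\varepsilon(E_i)=0$, $S(K_i)=K_i^{-1}$,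 $S(E_i)=-K_i^{-1}E_i$. $U_q^+(\mathfrak g)$ is regarded as a braided Hopf algebra: it is the Nichols algebra of $V=\bigoplus_i\Bbbk E_i$ with diagonal braiding $c(E_i\otimes E_j)=q^{d_ia_{ij}}E_j\otimes E_i$, with the $E_i$ primitive; $\mathrm{Aut}_{\rm Hopf}$ of it means linear bijections preserving product, unit, coproduct, counit and braiding. $\mathrm{Autdiagr}(\mathfrak g)$ is the group of automorphisms of the Dynkin diagram, i.e. permutations $\sigma$ of $\{1,\dots,n\}$ with $a_{\sigma(i)\sigma(j)}=a_{ij}$ for all $i,j$. *)

(* Defs.v *)
From HB Require Import structures.
From mathcomp Require Import all_boot all_order all_algebra all_fingroup.
From mathcomp Require Import finmap.
From mathcomp.multinomials Require Import monalg.

Set Implicit Arguments.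
Unset Strict Implicit.
Unset Printing Implicit Defensive.

Import Order.TTheory GRing.Theory Num.Theory.
Local Open Scope ring_scope.

(* Free associative algebra K<I> on an alphabet I, and K<I> (x) K<I>   *)
(* (as a vector space: finitely supported functions on pairs of words) *)

Notation FAlg K I := {malg K[{fmonom I}]}.
Notation TAlg K I := {malg K[({fmonom I} * {fmonom I})%type]}.

Section FreeAlgebra.
Variables (K : fieldType) (I : choiceType).
Local Notation W := {fmonom I}.

Definition gen (i : I) : FAlg K I := << fmu i >>.

Definition tens (x y : FAlg K I) : TAlg K I :=
  \sum_(u <- msupp x) \sum_(v <- msupp y) << x@_u * y@_v *g (u, v) >>.

Definition lext (V : lmodType K) (h : W -> V) (x : FAlg K I) : V :=
  \sum_(u <- msupp x) x@_u *: h u.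

Definition aext (B : lalgType K) (h : I -> B) : FAlg K I -> B :=
  lext (fun u : W => \prod_(i <- fmonom_val u) h i).

Definition antiext (B : lalgType K) (h : I -> B) : FAlg K I -> B :=
  lext (fun u : W => \prod_(i <- rev (fmonom_val u)) h i).

Definition tlext (V : lmodType K) (h : W * W -> V) (t : TAlg K I) : V :=
  \sum_(p <- msupp t) t@_p *: h p.

Definition tmap (f g : FAlg K I -> FAlg K I) : TAlg K I -> TAlg K I :=
  tlext (fun p => tens (f << p.1 >>) (g << p.2 >>)).

(* product on K<I> (x) K<I> twisted by a bicharacter chi on words:
   (u (x) v)(u' (x) v') = chi(v, u') uu' (x) vv'   (chi = 1: usual product) *)
Definition tmul (chi : W -> W -> K) (s t : TAlg K I) : TAlg K I :=
  \sum_(p <- msupp s) \sum_(p' <- msupp t)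
     << s@_p * t@_p' * chi p.2 p'.1 *g (fmmul p.1 p'.1, fmmul p.2 p'.2) >>.

Definition tone : TAlg K I := << (@fmone I, @fmone I) >>.

Definition coprod (chi : W -> W -> K) (D : I -> TAlg K I) : FAlg K I -> TAlg K I :=
  lext (fun u : W => foldr (fun i acc => tmul chi (D i) acc) tone (fmonom_val u)).

Definition tbraid (chi : W -> W -> K) : TAlg K I -> TAlg K I :=
  tlext (fun p => << chi p.1 p.2 *g (p.2, p.1) >>).

Definition in_ideal (P : FAlg K I -> Prop) (x : FAlg K I) : Prop :=
  exists s : seq (FAlg K I * FAlg K I * FAlg K I),
    (forall t, t \in s -> P t.1.2) /\ x = \sum_(t <- s) t.1.1 * t.1.2 * t.2.

(* the ideal  Id (x) K<I> + K<I> (x) Id  of K<I> (x) K<I>, Id = in_ideal P;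
   K<I>/Id (x) K<I>/Id = (K<I> (x) K<I>) / this subspace *)
Definition in_tideal (P : FAlg K I -> Prop) (t : TAlg K I) : Prop :=
  exists s : seq (FAlg K I * FAlg K I),
    (forall p, p \in s -> in_ideal P p.1 \/ in_ideal P p.2) /\
    t = \sum_(p <- s) tens p.1 p.2.

Definition is_linear (f : FAlg K I -> FAlg K I) : Prop :=
  forall (a : K) (x y : FAlg K I), f (a *: x + y) = a *: f x + f y.

(* The quotient H = K<I>/Id, Id = in_ideal P, carries the product, unit,
   coproduct (induced by coprod chi D), counit (induced by eps).  A linear
   map f : K<I> -> K<I> with f(Id) <= Id represents a linear map of H; the
   following says the induced map is a bijection of H preserving product,
   unit, coproduct and counit. *)
Definition bialg_aut (P : FAlg K I -> Prop) (chi : W -> W -> K)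
    (D : I -> TAlg K I) (eps : FAlg K I -> K) (f : FAlg K I -> FAlg K I) : Prop :=
  [/\ is_linear f,
      forall x, in_ideal P x -> in_ideal P (f x),
      exists g, [/\ is_linear g,
                    forall x, in_ideal P x -> in_ideal P (g x),
                    forall x, in_ideal P (g (f x) - x) &
                    forall x, in_ideal P (f (g x) - x)],
      forall x y, in_ideal P (f (x * y) - f x * f y) &
      in_ideal P (f 1 - 1)]
  /\ (forall x, in_tideal P (tmap f f (coprod chi D x) - coprod chi D (f x)))
  /\ (forall x, eps (f x) = eps x).

Definition braided_hopf_aut P chi D eps f : Prop :=
  bialg_aut P chi D eps f /\
  (forall t, in_tideal P (tmap f f (tbraid chi t) - tbraid chi (tmap f f t))).

Definition hopf_aut P chi D eps (S : FAlg K I -> FAlg K I) f : Prop :=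
  bialg_aut P chi D eps f /\ (forall x, in_ideal P (S (f x) - f (S x))).

End FreeAlgebra.

Definition symmetrized n (A : 'M[int]_n) (d : 'I_n -> nat) : 'M[rat]_n :=
  \matrix_(i, j) (((d i)%:Z * A i j)%:~R : rat).

(* A is the Cartan matrix of a finite dimensional simple Lie algebra of
   rank n: an indecomposable (generalized) Cartan matrix of finite type. *)
Definition simple_cartan_matrix n (A : 'M[int]_n) : Prop :=
  [/\ (0 < n)%N,
      forall i, A i i = 2,
      forall i j, i != j -> A i j <= 0,
      forall i j, A i j = 0 -> A j i = 0 &
      forall S : {set 'I_n}, S != set0 -> S != setT ->
        exists i j, [/\ i \in S, j \notin S & A i j != 0]]
  /\ exists d : 'I_n -> nat,
       (forall i, (0 < d i)%N) /\
       (forall i j, (d i)%:Z * A i j = (d j)%:Z * A j i) /\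
       (forall v : 'rV[rat]_n, v != 0 -> 0 < (v *m symmetrized A d *m v^T) 0 0).

Definition normalized_symmetrizer n (A : 'M[int]_n) (d : 'I_n -> nat) : Prop :=
  [/\ forall i, (0 < d i)%N,
      \big[gcdn/0%N]_(i < n) d i = 1%N &
      forall i j, (d i)%:Z * A i j = (d j)%:Z * A j i].

Definition diagram_aut n (A : 'M[int]_n) (s : {perm 'I_n}) : Prop :=
  forall i j, A (s i) (s j) = A i j.

Definition transcendental_over_Q (K : fieldType) (q : K) : Prop :=
  forall p : {poly rat}, p != 0 -> ~~ root (map_poly (ratr : rat -> K) p) q.

(* Gaussian binomial coefficients (symmetric convention)               *)
(*   [m]_t = (t^m - t^-m)/(t - t^-1) = t^(m-1) + t^(m-3) + ... + t^(1-m) *)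
Section Gauss.
Variable (K : fieldType).
Definition qint (t : K) (m : nat) : K :=
  \sum_(k < m) t ^ ((m.-1)%:Z - 2 * (k : nat)%:Z).
Definition qfact (t : K) (m : nat) : K := \prod_(k < m) qint t k.+1.
Definition qbinom (t : K) (m k : nat) : K :=
  qfact t m / (qfact t k * qfact t (m - k)).
End Gauss.

Section Quantum.
Variables (K : fieldType) (q : K) (n : nat) (A : 'M[int]_n) (d : 'I_n -> nat).

Definition serre (B : lalgType K) (E : 'I_n -> B) (i j : 'I_n) : B :=
  let m := absz (1 - A i j) in
  \sum_(nu < m.+1)
     qbinom (q ^+ d i) m nu *: (E i ^+ (m - nu) * E j * (- E i) ^+ nu).

Definition Eplus (i : 'I_n) : FAlg K 'I_n := gen K i.

Definition rels_plus (x : FAlg K 'I_n) : Prop :=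
  exists i j, i != j /\ x = serre Eplus i j.

(* bicharacter of the diagonal braiding c(E_i (x) E_j) = q^(d_i a_ij) E_j (x) E_i,
   on words (= homogeneous elements) *)
Definition chi_plus (u v : {fmonom 'I_n}) : K :=
  \prod_(a <- fmonom_val u) \prod_(b <- fmonom_val v) q ^ ((d a)%:Z * A a b).

(* E_i primitive; coproduct multiplicative for the braided tensor product *)
Definition D_plus (i : 'I_n) : TAlg K 'I_n :=
  tens (Eplus i) 1 + tens 1 (Eplus i).

Definition eps_plus (x : FAlg K 'I_n) : K := x@_(@fmone 'I_n).

Definition HopfAut_Uplus (f : FAlg K 'I_n -> FAlg K 'I_n) : Prop :=
  braided_hopf_aut rels_plus chi_plus D_plus eps_plus f.

(* E_i |-> alpha_(s i) E_(s i)  (= torus element alpha after diagram aut s) *)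
Definition phi_plus (alpha : 'I_n -> K) (s : {perm 'I_n}) :
    FAlg K 'I_n -> FAlg K 'I_n :=
  aext (fun i => alpha (s i) *: Eplus (s i)).

Definition eq_mod_plus (x y : FAlg K 'I_n) : Prop := in_ideal rels_plus (x - y).

(* --- U_q(b^+): generators E_i (inl (inl i)), K_i (inl (inr i)), K_i^-1 (inr i) --- *)
Definition bgen : choiceType := ('I_n + 'I_n + 'I_n)%type.

Definition Eb (i : 'I_n) : FAlg K bgen := gen K (inl (inl i) : bgen).
Definition Kb (i : 'I_n) : FAlg K bgen := gen K (inl (inr i) : bgen).
Definition Kib (i : 'I_n) : FAlg K bgen := gen K (inr i : bgen).

Definition rels_b (x : FAlg K bgen) : Prop :=
  (exists i j, i != j /\ x = serre Eb i j) \/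
  (exists i, x = Kb i * Kib i - 1) \/
  (exists i, x = Kib i * Kb i - 1) \/
  (exists i j, x = Kb i * Kb j - Kb j * Kb i) \/
  (exists i j, x = Kb i * Eb j - q ^ ((d i)%:Z * A i j) *: (Eb j * Kb i)).

Definition chi_b (u v : {fmonom bgen}) : K := 1.

Definition D_b (l : bgen) : TAlg K bgen :=
  match l with
  | inl (inl i) => tens (Eb i) 1 + tens (Kb i) (Eb i)
  | inl (inr i) => tens (Kb i) (Kb i)
  | inr i => tens (Kib i) (Kib i)
  end.

Definition eps_b (x : FAlg K bgen) : K :=
  \sum_(u <- msupp x) x@_u *
     \prod_(l <- fmonom_val u) (match l with inl (inl _) => 0 | _ => 1 end).

Definition S_b : FAlg K bgen -> FAlg K bgen :=
  antiext (fun l : bgen => match l with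
           | inl (inl i) => - (Kib i * Eb i)
           | inl (inr i) => Kib i
           | inr i => Kb i
           end).

Definition HopfAut_Ub (f : FAlg K bgen -> FAlg K bgen) : Prop :=
  hopf_aut rels_b chi_b D_b eps_b S_b f.

Definition phi_b (alpha : 'I_n -> K) (s : {perm 'I_n}) :
    FAlg K bgen -> FAlg K bgen :=
  aext (fun l : bgen => match l with
        | inl (inl i) => alpha (s i) *: Eb (s i)
        | inl (inr i) => Kb (s i)
        | inr i => Kib (s i)
        end).

Definition eq_mod_b (x y : FAlg K bgen) : Prop := in_ideal rels_b (x - y).

(* "Aut_Hopf(H) ~= (K^x)^n x| Autdiagr(g)" via (alpha, s) |-> phi alpha s:   *)
(* phi alpha s is a Hopf automorphism, every Hopf automorphism equals (on   *)
(* the quotient) a unique phi alpha s, and composition corresponds to the   *)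
(* semidirect product law (alpha, s)(beta, t) = (alpha * (beta o s^-1), s o t). *)
Definition torus_diag_iso (T : Type) (Aut : (T -> T) -> Prop)
    (eqm : T -> T -> Prop) (phi : ('I_n -> K) -> {perm 'I_n} -> T -> T) : Prop :=
  let valid alpha s := (forall i, alpha i != 0) /\ diagram_aut A s in
  [/\ forall alpha s, valid alpha s -> Aut (phi alpha s),
      forall f, Aut f -> exists alpha s, valid alpha s /\ forall x, eqm (f x) (phi alpha s x),
      forall alpha s beta t, valid alpha s -> valid beta t ->
        (forall x, eqm (phi alpha s x) (phi beta t x)) -> alpha =1 beta /\ s = t &
      forall alpha s beta t, valid alpha s -> valid beta t ->
        forall x, eqm (phi alpha s (phi beta t x))
                      (phi (fun k => alpha k * beta ((s^-1)%g k)) (t * s)%g x)].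

End Quantum.

(* Main.v *)
Require Import Defs.
From HB Require Import structures.
From Stdlib Require Import Classical_Prop Setoid Morphisms.
From mathcomp Require Import all_boot all_order all_algebra all_fingroup.
From mathcomp Require Import finmap.
From mathcomp.multinomials Require Import monalg.
From mathcomp Require Import zify ring.
Import GRing.Theory.
Local Open Scope ring_scope.

(* Both parts only use that the defining relations are homogeneous and that
   the [E_k] do not vanish in the quotient; neither a PBW basis nor the
   primitive elements of a Nichols algebra are needed.

   U_q^+: let [f] be an automorphism, [x = f(E_i)] and [f(z) = E_k].
   Contracting the compatibility of [f] with the braiding on [E_i (x) z] with
   the functional "coefficient of [E_k]" gives
   [t x = sum_b q^(b, a_k) x_b] for a scalar [t], where [x_b] is the component
   of weight [b].  So [x_b <> 0] determines [(b, a_k)] for every simple root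
   [a_k], hence [b], and [f(E_i)] is homogeneous of a weight [b_i >= 0].
   By surjectivity every simple root is a sum of some [b_i]; so the [b_i] are
   the simple roots in some order [s], and [f(E_i)] is a multiple of
   [E_(s i)].  Compatibility with the braiding then gives
   [(a_(s i), a_(s j)) = (a_i, a_j)].

   U_q(b^+): the K-content of words is a second grading.  For the character
   [lam_v = eps o (projection on K-content v)], contracting [Delta y] with
   [lam_v] on the right (left) projects [y] on K-content [v] (on
   K-content + weight = [v]).  Applied to [Delta G = G (x) G] this shows that
   [G = f(K_i)] is a single [K_m]; applied to
   [Delta x = x (x) 1 + G (x) x], [x = f(E_i)], it shows that [x] has weight [m].
   Surjectivity concludes as before. *)

Set Implicit Arguments.
Unset Strict Implicit.
Unset Printing Implicit Defensive.

Import Order.TTheory Num.Theory.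

(** * Free algebras and their tensor squares *)

(* Both are used only through these interfaces: on the concrete [malg] types,
   unification unfolds the operations and rewriting becomes intractable. *)
Section Interface.
Variables (K : fieldType) (I : choiceType).
Local Notation W := {fmonom I}.

Structure free_alg := FreeAlg {
  fa_car :> algType K;
  bs : W -> fa_car;
  bs1 : bs (@fmone I) = 1;
  bsM : forall u v, bs (fmmul u v) = bs u * bs v;
  bs_ind : forall Q : fa_car -> Prop,
    Q 0 -> (forall c u x, Q x -> Q (c *: bs u + x)) -> forall x, Q x;
  lin : forall V : lmodType K, (W -> V) -> fa_car -> V;
  lin_linear : forall (V : lmodType K) (h : W -> V), linear (lin h);
  lin_bs : forall (V : lmodType K) (h : W -> V) u, lin h (bs u) = h u
}.

(** The weighted monomial [upt] is a field besides [pt] so that, in the concrete model, [tbr]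
    unfolds to [tbraid] by conversion. *)
Structure tens_sq (F : free_alg) := TensSq {
  ts_car :> lmodType K;
  pt : W * W -> ts_car;
  pt_ind : forall Q : ts_car -> Prop,
    Q 0 -> (forall c p x, Q x -> Q (c *: pt p + x)) -> forall x, Q x;
  upt : K -> W * W -> ts_car;
  uptE : forall c p, upt c p = c *: pt p;
  tlin : forall V : lmodType K, (W * W -> V) -> ts_car -> V;
  tlin_linear : forall (V : lmodType K) (h : W * W -> V), linear (tlin h);
  tlin_pt : forall (V : lmodType K) (h : W * W -> V) p, tlin h (pt p) = h p;
  ten : F -> F -> ts_car;
  ten_linl : forall y, linear (ten^~ y);
  ten_linr : forall x, linear (ten x);
  ten_bs : forall u v, ten (bs F u) (bs F v) = pt (u, v);
  tmu : (W -> W -> K) -> ts_car -> ts_car -> ts_car;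
  tmu_linl : forall chi y, linear ((tmu chi)^~ y);
  tmu_linr : forall chi x, linear (tmu chi x);
  tmu_pt : forall chi p p', tmu chi (pt p) (pt p') =
    chi p.2 p'.1 *: pt (fmmul p.1 p'.1, fmmul p.2 p'.2)
}.

End Interface.

Section Linear.
Variables (K : fieldType) (I : choiceType) (F : free_alg K I) (T : tens_sq F).

HB.instance Definition _ (V : lmodType K) (h : {fmonom I} -> V) :=
  GRing.isLinear.Build K F V *:%R (lin h) (@lin_linear _ _ F V h).
HB.instance Definition _ (V : lmodType K) (h : {fmonom I} * {fmonom I} -> V) :=
  GRing.isLinear.Build K T V *:%R (tlin h) (@tlin_linear _ _ _ T V h).
HB.instance Definition _ (x : F) :=
  GRing.isLinear.Build K F T *:%R (ten T x) (ten_linr T x).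
HB.instance Definition _ chi (x : T) :=
  GRing.isLinear.Build K T T *:%R (tmu chi x) (@tmu_linr _ _ _ T chi x).

Lemma linear_zero (U V : lmodType K) (f : U -> V) : linear f -> f 0 = 0.
Proof. by move=> lf; have := lf (-1) 0 0; rewrite !scaler0 add0r scaleN1r addNr. Qed.

Lemma linear_scale (U V : lmodType K) (f : U -> V) c x :
  linear f -> f (c *: x) = c *: f x.
Proof. by move=> lf; rewrite -[c *: x]addr0 lf linear_zero // addr0. Qed.

Lemma linear_add (U V : lmodType K) (f : U -> V) x y :
  linear f -> f (x + y) = f x + f y.
Proof. by move=> lf; rewrite -[x]scale1r lf !scale1r. Qed.

Lemma linear_sub (U V : lmodType K) (f : U -> V) x y :
  linear f -> f (x - y) = f x - f y.
Proof. by move=> lf; rewrite addrC -scaleN1r lf scaleN1r addrC. Qed.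

Lemma ten0l (x : F) : ten T 0 x = 0.
Proof. exact: (linear_zero (ten_linl T x)). Qed.
Lemma tenZl c (x y : F) : ten T (c *: x) y = c *: ten T x y.
Proof. exact: (linear_scale _ _ (ten_linl T y)). Qed.
Lemma tenDl (x x' y : F) : ten T (x + x') y = ten T x y + ten T x' y.
Proof. exact: (linear_add _ _ (ten_linl T y)). Qed.
Lemma tmu0l chi (x : T) : tmu chi 0 x = 0.
Proof. exact: (linear_zero (@tmu_linl _ _ _ T chi x)). Qed.
Lemma tmuZl chi c (x y : T) : tmu chi (c *: x) y = c *: tmu chi x y.
Proof. exact: (linear_scale _ _ (@tmu_linl _ _ _ T chi y)). Qed.
Lemma tmuDl chi (x x' y : T) : tmu chi (x + x') y = tmu chi x y + tmu chi x' y.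
Proof. exact: (linear_add _ _ (@tmu_linl _ _ _ T chi y)). Qed.

Lemma linear_bs_ext (V : lmodType K) (f g : F -> V) : linear f -> linear g ->
  (forall u, f (bs F u) = g (bs F u)) -> f =1 g.
Proof.
move=> lf lg efg; elim/bs_ind => [|c u x IHx]; first by rewrite !linear_zero.
by rewrite lf lg efg IHx.
Qed.

Lemma linear_pt_ext (V : lmodType K) (f g : T -> V) : linear f -> linear g ->
  (forall p, f (pt T p) = g (pt T p)) -> f =1 g.
Proof.
move=> lf lg efg; elim/pt_ind => [|c u x IHx]; first by rewrite !linear_zero.
by rewrite lf lg efg IHx.
Qed.

Definition wd (s : seq I) : F := bs F (FMonom s).

Lemma bs_wd u : bs F u = wd (fmonom_val u).
Proof. by case: u. Qed.

Definition gn (l : I) : F := bs F (fmu l).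

Lemma wd_cat s t : wd (s ++ t) = wd s * wd t.
Proof. by rewrite -bsM fmmulE. Qed.

Lemma wd_nil : wd [::] = 1.
Proof. by rewrite /wd -fmoneE bs1. Qed.

Lemma wd_gen l : wd [:: l] = gn l.
Proof. by rewrite /gn fmuE. Qed.

Lemma wd_cons l s : wd (l :: s) = gn l * wd s.
Proof. by rewrite -cat1s wd_cat wd_gen. Qed.

Lemma falg_ind (Q : F -> Prop) :
  Q 0 -> (forall c s x, Q x -> Q (c *: wd s + x)) -> forall x, Q x.
Proof. by move=> Q0 QD; elim/bs_ind => // c u x; rewrite bs_wd; apply: QD. Qed.

Section AlgebraExtension.
Variables (B : algType K) (h : I -> B).

Definition fext : F -> B := lin (fun u => \prod_(i <- fmonom_val u) h i).
HB.instance Definition _ := GRing.Linear.on fext.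

Lemma fext_wd s : fext (wd s) = \prod_(i <- s) h i.
Proof. exact: lin_bs. Qed.

Lemma fext_gn i : fext (gn i) = h i.
Proof. by rewrite -wd_gen fext_wd big_seq1. Qed.

Fact fext_monoid_morphism : monoid_morphism fext.
Proof.
split=> [|x y]; first by rewrite -wd_nil fext_wd big_nil.
elim/falg_ind: x => [|c s x IHx]; first by rewrite mul0r !linear0 mul0r.
rewrite mulrDl -scalerAl !linearD !linearZ_LR /= IHx mulrDl -scalerAl.
congr (_ *: _ + _).
elim/falg_ind: y {IHx} => [|e t y IHy]; first by rewrite mulr0 !linear0 mulr0.
rewrite mulrDr -scalerAr !linearD !linearZ_LR /= IHy mulrDr -scalerAr.
by rewrite -wd_cat !fext_wd big_cat.
Qed.
HB.instance Definition _ :=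
  GRing.isMonoidMorphism.Build F B fext fext_monoid_morphism.
End AlgebraExtension.

Lemma lrmorph_falg_ext (B : algType K) (f g : {lrmorphism F -> B}) :
  (forall i, f (gn i) = g (gn i)) -> f =1 g.
Proof.
move=> efg; apply: linear_bs_ext => [||u]; try exact: linearP.
rewrite bs_wd; elim: (fmonom_val u) => [|i s IHs].
  by rewrite wd_nil !rmorph1.
by rewrite wd_cons !rmorphM /= efg IHs.
Qed.

Definition tm (f g : F -> F) : T -> T :=
  tlin (fun p => ten T (f (bs F p.1)) (g (bs F p.2))).
HB.instance Definition _ f g := GRing.Linear.on (tm f g).

Lemma tm_ten (f g : F -> F) x y : linear f -> linear g ->
  tm f g (ten T x y) = ten T (f x) (g y).
Proof.
move=> lf lg.
elim/bs_ind: x => [|c u x IHx]; first by rewrite (linear_zero lf) !ten0l linear0.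
rewrite !(lf, tenDl, tenZl) linearP /= IHx; congr (_ *: _ + _).
elim/bs_ind: y {IHx} => [|e v y IHy]; first by rewrite (linear_zero lg) !linear0.
by rewrite !lg !linearP /= IHy ten_bs /tm tlin_pt.
Qed.

(* [slicel lam] is [lam (x) id] and [slicer lam] is [id (x) lam]. *)
Definition slicel (lam : F -> K) : T -> F :=
  tlin (fun p => lam (bs F p.1) *: bs F p.2).
Definition slicer (lam : F -> K) : T -> F :=
  tlin (fun p => lam (bs F p.2) *: bs F p.1).
HB.instance Definition _ lam := GRing.Linear.on (slicel lam).
HB.instance Definition _ lam := GRing.Linear.on (slicer lam).

Variable lam : {linear F -> K^o}.

Lemma slicel_ten x y : slicel lam (ten T x y) = lam x *: y.
Proof.
elim/bs_ind: x => [|c u x IHx]; first by rewrite ten0l !linear0 ?scale0r.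
rewrite !(tenDl, tenZl) !linearP /= IHx scalerDl -scalerA; congr (_ *: _ + _).
elim/bs_ind: y {IHx} => [|e v y IHy]; first by rewrite !linear0 ?scaler0.
by rewrite !linearP /= IHy ten_bs /slicel tlin_pt.
Qed.

Lemma slicer_ten x y : slicer lam (ten T x y) = lam y *: x.
Proof.
elim/bs_ind: x => [|c u x IHx]; first by rewrite ten0l !linear0 ?scaler0.
rewrite !(tenDl, tenZl) !linearP /= IHx; congr (_ *: _ + _).
elim/bs_ind: y {IHx} => [|e v y IHy]; first by rewrite !linear0 ?scale0r.
by rewrite !linearP /= IHy ten_bs /slicer tlin_pt scalerDl /= -scalerA.
Qed.

End Linear.
Arguments wd {K I} F s.
Arguments gn {K I} F l.
Arguments fext {K I} F {B} h _.
Arguments tm {K I F} T f g _.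

(** * Ideals and gradings *)

Section Ideal.
Variables (K : fieldType) (I : choiceType) (F : free_alg K I) (T : tens_sq F).
Variable P : F -> Prop.

Definition ideal (x : F) : Prop :=
  exists s : seq (F * F * F),
    (forall t, t \in s -> P t.1.2) /\ x = \sum_(t <- s) t.1.1 * t.1.2 * t.2.

Definition tideal (t : T) : Prop :=
  exists s : seq (F * F),
    (forall p, p \in s -> ideal p.1 \/ ideal p.2) /\
    t = \sum_(p <- s) ten T p.1 p.2.

Local Notation Id := ideal.

Lemma ideal0 : Id 0.
Proof. by exists [::]; split=> //; rewrite big_nil. Qed.

Lemma idealD x y : Id x -> Id y -> Id (x + y).
Proof.
move=> [s [Ps ->]] [t [Pt ->]]; exists (s ++ t); split; last by rewrite big_cat.
by move=> z; rewrite mem_cat => /orP[/Ps|/Pt].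
Qed.

Lemma idealMl a x : Id x -> Id (a * x).
Proof.
move=> [s [Ps ->]]; exists [seq (a * t.1.1, t.1.2, t.2) | t <- s]; split.
  by move=> _ /mapP[t /Ps Pt ->].
by rewrite big_map mulr_sumr; apply: eq_bigr => t _; rewrite !mulrA.
Qed.

Lemma idealMr a x : Id x -> Id (x * a).
Proof.
move=> [s [Ps ->]]; exists [seq (t.1.1, t.1.2, t.2 * a) | t <- s]; split.
  by move=> _ /mapP[t /Ps Pt ->].
by rewrite big_map mulr_suml; apply: eq_bigr => t _; rewrite !mulrA.
Qed.

Lemma idealZ c x : Id x -> Id (c *: x).
Proof. by move=> Ix; rewrite -[x]mul1r scalerAl; apply: idealMl. Qed.

Lemma idealN x : Id x -> Id (- x).
Proof. by move=> Ix; rewrite -scaleN1r; apply: idealZ. Qed.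

Lemma idealB x y : Id x -> Id y -> Id (x - y).
Proof. by move=> Ix Iy; apply/idealD/idealN. Qed.

Lemma ideal_gen x : P x -> Id x.
Proof.
move=> Px; exists [:: (1, x, 1)]; split=> [t|].
  by rewrite inE => /eqP->.
by rewrite big_seq1 mul1r mulr1.
Qed.

Lemma idealZK c x : c != 0 -> Id (c *: x) -> Id x.
Proof. by move=> c0 /(idealZ c^-1); rewrite scalerA mulVf // scale1r. Qed.

Lemma ideal_sum (J : eqType) (s : seq J) (G : J -> F) :
  (forall j, j \in s -> Id (G j)) -> Id (\sum_(j <- s) G j).
Proof.
elim: s => [|j s IHs] IdG; first by rewrite big_nil; apply: ideal0.
rewrite big_cons; apply: idealD; first by apply: IdG; rewrite mem_head.
by apply: IHs => k ks; apply: IdG; rewrite in_cons ks orbT.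
Qed.

Lemma ideal_ker (B : algType K) (f : {lrmorphism F -> B}) :
  (forall x, P x -> f x = 0) -> forall x, Id x -> f x = 0.
Proof.
move=> fP x [s [Ps ->]]; rewrite linear_sum big_seq big1 // => t /Ps /fP ft.
by rewrite !rmorphM /= ft mulr0 mul0r.
Qed.

(** A summand with left factor in the ideal is killed by [lam]; one with right factor in the ideal
    becomes a multiple of that factor. Contraction thus turns identities modulo [tideal] into
    identities in the quotient algebra. *)
Lemma tideal_slicel (lam : {linear F -> K^o}) t :
  (forall x, Id x -> lam x = 0) -> tideal t -> Id (slicel lam t).
Proof.
move=> lam0 [s [Ps ->]]; rewrite linear_sum /=; apply: ideal_sum => p /Ps.
rewrite slicel_ten => -[/lam0->|]; last exact: idealZ.
by rewrite scale0r; apply: ideal0.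
Qed.

Lemma tideal_slicer (lam : {linear F -> K^o}) t :
  (forall x, Id x -> lam x = 0) -> tideal t -> Id (slicer lam t).
Proof.
move=> lam0 [s [Ps ->]]; rewrite linear_sum /=; apply: ideal_sum => p /Ps.
rewrite slicer_ten => -[|/lam0->]; first exact: idealZ.
by rewrite scale0r; apply: ideal0.
Qed.

Lemma tideal0 : tideal 0.
Proof. by exists [::]; split=> //; rewrite big_nil. Qed.

Definition eqI (x y : F) : Prop := Id (x - y).

Lemma eqI_refl x : eqI x x.
Proof. by rewrite /eqI subrr; apply: ideal0. Qed.

#[local] Hint Resolve eqI_refl ideal0 : core.

Lemma eqI_sym x y : eqI x y -> eqI y x.
Proof. by move=> /idealN; rewrite opprB. Qed.

Lemma eqI_trans y x z : eqI x y -> eqI y z -> eqI x z.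
Proof. by move=> xy yz; have := idealD xy yz; rewrite addrA subrK. Qed.

Lemma eqI0 x : eqI x 0 <-> Id x.
Proof. by rewrite /eqI subr0. Qed.

#[export] Instance eqI_equiv : Equivalence eqI.
Proof.
by split; [exact: eqI_refl|exact: eqI_sym|move=> x y z; exact: eqI_trans].
Qed.

#[export] Instance eqI_add : Proper (eqI ==> eqI ==> eqI) (@GRing.add F).
Proof. by move=> x x' ex y y' ey; rewrite /eqI opprD addrACA; apply: idealD. Qed.

#[export] Instance eqI_opp : Proper (eqI ==> eqI) (@GRing.opp F).
Proof. by move=> x x' ex; rewrite /eqI -opprD; apply: idealN. Qed.

#[export] Instance eqI_scale : Proper (eq ==> eqI ==> eqI) (@GRing.scale K F).
Proof. by move=> c _ <- x x' ex; rewrite /eqI -scalerBr; apply: idealZ. Qed.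

#[export] Instance eqI_mul : Proper (eqI ==> eqI ==> eqI) (@GRing.mul F).
Proof.
move=> x x' ex y y' ey; apply: (@eqI_trans (x' * y)).
  by rewrite /eqI -mulrBl; apply: idealMr.
by rewrite /eqI -mulrBr; apply: idealMl.
Qed.

#[export] Instance eqI_ideal : Proper (eqI ==> iff) ideal.
Proof. by move=> x y xy; rewrite -!eqI0; split=> [|y0]; rewrite xy. Qed.

(* The morphisms of the quotient algebra, represented upstairs. *)
Definition alg_mod (f : F -> F) : Prop :=
  [/\ linear f, forall x, Id x -> Id (f x), eqI (f 1) 1 &
      forall x y, eqI (f (x * y)) (f x * f y)].

Lemma alg_mod_eqI f x y : alg_mod f -> eqI x y -> eqI (f x) (f y).
Proof. by case=> lf If _ _ xy; rewrite /eqI -linear_sub //; apply: If. Qed.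

Lemma eqI_linear_wd (f g : F -> F) : linear f -> linear g ->
  (forall s, eqI (f (wd F s)) (g (wd F s))) -> forall x, eqI (f x) (g x).
Proof.
move=> lf lg fg; elim/falg_ind => [|c s x IHx].
  by rewrite (linear_zero lf) (linear_zero lg).
by rewrite lf lg fg IHx.
Qed.

Lemma alg_mod_ext f g : alg_mod f -> alg_mod g ->
  (forall l, eqI (f (gn F l)) (g (gn F l))) -> forall x, eqI (f x) (g x).
Proof.
move=> [lf _ f1 fM] [lg _ g1 gM] fg; apply: eqI_linear_wd => //.
elim=> [|l s IHs]; first by rewrite wd_nil f1 g1.
by rewrite wd_cons fM gM fg IHs.
Qed.

Lemma ideal_preserved (f : {lrmorphism F -> F}) :
  (forall x, P x -> Id (f x)) -> forall x, Id x -> Id (f x).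
Proof.
move=> fP x [s [Ps ->]]; rewrite linear_sum /=; apply: ideal_sum => t /Ps /fP ft.
by rewrite !rmorphM; apply/idealMr/idealMl.
Qed.

End Ideal.
#[export] Hint Resolve ideal0 eqI_refl : core.

(** * Gradings of the free algebra and homogeneous ideals *)

Section Grading.
Variables (K : fieldType) (I : choiceType) (F : free_alg K I) (M : zmodType).
Variable wt : I -> M.

Definition wtw (s : seq I) : M := \sum_(l <- s) wt l.

Lemma wtw_cat s t : wtw (s ++ t) = wtw s + wtw t.
Proof. exact: big_cat. Qed.
Lemma wtw_cons l s : wtw (l :: s) = wt l + wtw s.
Proof. exact: big_cons. Qed.
Lemma wtw_nil : wtw [::] = 0.
Proof. exact: big_nil. Qed.

Definition proj (m : M) : F -> F :=
  lin (fun u => if wtw (fmonom_val u) == m then bs F u else 0).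
HB.instance Definition _ m := GRing.Linear.on (proj m).

Lemma proj_wd m s : proj m (wd F s) = if wtw s == m then wd F s else 0.
Proof. exact: lin_bs. Qed.

Lemma proj_proj m m' x : proj m (proj m' x) = if m == m' then proj m x else 0.
Proof.
elim/falg_ind: x => [|c s x IHx]; first by rewrite !linear0 if_same.
rewrite !(linearD, linearZ) /= IHx.
have -> : proj m (proj m' (wd F s)) = if m == m' then proj m (wd F s) else 0.
  rewrite !proj_wd; case: (eqVneq (wtw s) m') => [|ne].
    by rewrite proj_wd [wtw s == m]eq_sym => ->; case: (m == m').
  by rewrite linear0; case: eqP => // ->; rewrite (negPf ne).
by case: ifP => // _; rewrite scaler0 addr0.
Qed.

Lemma proj_id m x : proj m (proj m x) = proj m x.
Proof. by rewrite proj_proj eqxx. Qed.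

Lemma proj_mull m s x : proj m (wd F s * x) = wd F s * proj (m - wtw s) x.
Proof.
elim/falg_ind: x => [|c t x IHx]; first by rewrite !(linear0, mulr0).
rewrite mulrDr -scalerAr -wd_cat !(linearD, linearZ) /= IHx !proj_wd.
rewrite mulrDr -scalerAr wtw_cat wd_cat [wtw s + _]addrC.
by rewrite [_ == m - _]eq_sym subr_eq [m == _]eq_sym; case: eqP; rewrite ?mulr0.
Qed.

Lemma proj_mulr m s x : proj m (x * wd F s) = proj (m - wtw s) x * wd F s.
Proof.
elim/falg_ind: x => [|c t x IHx]; first by rewrite !(linear0, mul0r).
rewrite mulrDl -scalerAl -wd_cat !(linearD, linearZ) /= IHx !proj_wd.
rewrite mulrDl -scalerAl wtw_cat wd_cat [_ == m - _]eq_sym subr_eq [m == _]eq_sym.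
by case: eqP; rewrite ?mul0r.
Qed.

(** Stated as a fixed point of the projection, so that 0 is homogeneous of every weight. *)
Definition homog m x := proj m x = x.

Lemma homogD m x y : homog m x -> homog m y -> homog m (x + y).
Proof. by rewrite /homog linearD /= => -> ->. Qed.
Lemma homogZ m c x : homog m x -> homog m (c *: x).
Proof. by rewrite /homog linearZ /= => ->. Qed.
Lemma homogN m x : homog m x -> homog m (- x).
Proof. by rewrite /homog linearN /= => ->. Qed.
Lemma homog_wd s : homog (wtw s) (wd F s).
Proof. by rewrite /homog proj_wd eqxx. Qed.
Lemma homog_gen l : homog (wt l) (gn F l).
Proof. by rewrite -wd_gen -[wt l]addr0 -wtw_nil -wtw_cons; apply: homog_wd. Qed.
Lemma homog_proj m x : homog m (proj m x).
Proof. exact: proj_id. Qed.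

Lemma homogM m m' x y : homog m x -> homog m' y -> homog (m + m') (x * y).
Proof.
move=> <- <-; elim/falg_ind: x => [|c s x IHx].
  by rewrite linear0 mul0r /homog linear0.
rewrite linearD linearZ /= mulrDl -scalerAl proj_wd; apply: homogD => //.
apply: homogZ; have [<-|_] := eqVneq; last by rewrite mul0r /homog linear0.
by rewrite /homog proj_mull addrC addrA addNr add0r proj_id.
Qed.

Lemma homogX m x k : homog m x -> homog (m *+ k) (x ^+ k).
Proof.
move=> mx; elim: k => [|k IHk]; last by rewrite exprS mulrS; apply: homogM.
by rewrite expr0 mulr0n -wd_nil -wtw_nil; apply: homog_wd.
Qed.

Lemma homog_sum (J : Type) (r : seq J) (Q : pred J) (G : J -> F) m :
  (forall j, Q j -> homog m (G j)) -> homog m (\sum_(j <- r | Q j) G j).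
Proof. by move=> hG; rewrite /homog linear_sum; apply: eq_bigr. Qed.

Lemma homog_proj_neq m m' x : homog m x -> m' != m -> proj m' x = 0.
Proof. by move=> <- /negPf nm; rewrite proj_proj nm. Qed.

Lemma proj_decomp x : exists ms, uniq ms /\ x = \sum_(m <- ms) proj m x.
Proof.
(* The induction needs the decomposition over every duplicate-free list containing [ms], because
   each further word may bring a new weight. *)
suff [ms hms] : exists ms : seq M, forall ms', uniq ms' -> {subset ms <= ms'} ->
    x = \sum_(m <- ms') proj m x.
  exists (undup ms); split; first exact: undup_uniq.
  by apply: hms => [|m]; rewrite ?undup_uniq ?mem_undup.
elim/falg_ind: x => [|c s x [ms IHx]].
  by exists [::] => ms' _ _; rewrite big1 // => m _; rewrite linear0.
exists (wtw s :: ms) => ms' ums' sub.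
under eq_bigr do rewrite linearD linearZ /= proj_wd.
rewrite big_split /= -IHx //; last first.
  by move=> m ms_m; apply: sub; rewrite in_cons ms_m orbT.
rewrite (bigD1_seq (wtw s)) ?sub ?mem_head //= eqxx big1 ?addr0 // => m.
by rewrite eq_sym => /negPf->; rewrite scaler0.
Qed.

(** Weights that occur are sums of weights of letters; this later makes them nonnegative. *)
Lemma proj_neq0 m x : proj m x <> 0 -> exists s, wtw s = m.
Proof.
move=> nz; apply: NNPP => ns; apply: nz.
elim/falg_ind: x => [|c s x IHx]; first by rewrite linear0.
rewrite linearP /= IHx addr0 proj_wd; have [e|_] := eqVneq; last by rewrite scaler0.
by case: ns; exists s.
Qed.

Section HomogeneousIdeal.
Variable P : F -> Prop.
Local Notation Id := (ideal P).
Hypothesis homP : forall r, P r -> exists m, homog m r.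

(** On a product of a word, a homogeneous relation and a word, the projection is either the identity
    or zero. *)
Lemma ideal_proj m x : Id x -> Id (proj m x).
Proof.
move=> [s [Ps ->]]; rewrite linear_sum /=; apply: ideal_sum => -[[a r] b] /Ps /=.
move=> Pr; elim/falg_ind: a => [|c u a IHa]; first by rewrite !mul0r linear0.
rewrite !mulrDl -!scalerAl linearP /=; apply: idealD => //; apply: idealZ.
elim/falg_ind: b {IHa} => [|e v b IHb]; first by rewrite mulr0 linear0.
rewrite mulrDr -scalerAr linearP /=; apply: idealD => //; apply: idealZ.
rewrite proj_mulr proj_mull; apply/idealMr/idealMl.
have [m0 hr] := homP Pr.
have [->|/(homog_proj_neq hr)->//] := eqVneq (m - wtw v - wtw u) m0.
by rewrite hr; apply: ideal_gen.
Qed.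

Lemma eqI_proj m x y : eqI P x y -> eqI P (proj m x) (proj m y).
Proof. by move=> /(ideal_proj m); rewrite linearB. Qed.

(** Homogeneity of the class of [x] in the quotient: [x] may have other components, as long as they
    lie in the ideal. *)
Definition mhom m x := eqI P x (proj m x).

Lemma mhomW m x : (forall m', m' != m -> Id (proj m' x)) -> mhom m x.
Proof.
move=> hx; have [ms [ums ex]] := proj_decomp x; rewrite /mhom /eqI.
have [mms|nms] := boolP (m \in ms).
  rewrite {1}ex (bigD1_seq m) //= addrAC subrr add0r -big_filter.
  by apply: ideal_sum => k; rewrite mem_filter => /andP[/hx].
have -> : proj m x = 0.
  rewrite ex linear_sum big_seq big1 //= => k kms; rewrite proj_proj.
  by case: eqP nms => // ->; rewrite kms.
rewrite subr0 ex; apply: ideal_sum => k kms; apply: hx.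
by apply: contraNneq nms => <-.
Qed.

Lemma mhom_proj m m' x : mhom m x -> m' != m -> Id (proj m' x).
Proof.
move=> /(eqI_proj m') hx /negPf nm; move: hx; rewrite proj_proj nm.
by rewrite /eqI subr0.
Qed.

Lemma mhom_homog m x : homog m x -> mhom m x.
Proof. by rewrite /mhom => ->. Qed.

Lemma mhom_eqI m x y : eqI P x y -> mhom m y -> mhom m x.
Proof.
move=> xy my; have ey : eqI P y (proj m y) := my.
by rewrite /mhom (eqI_proj m xy) -ey.
Qed.

Lemma mhomM m m' x y : mhom m x -> mhom m' y -> mhom (m + m') (x * y).
Proof.
move=> mx my; apply: (@mhom_eqI _ _ (proj m x * proj m' y)).
  have ex : eqI P x (proj m x) := mx; have ey : eqI P y (proj m' y) := my.
  by rewrite -ex -ey.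
by apply/mhom_homog/homogM; apply: homog_proj.
Qed.

Lemma nonideal_proj x : ~ Id x -> exists m, ~ Id (proj m x).
Proof.
move=> nx; apply: NNPP => all; apply: nx.
have [ms [_ ->]] := proj_decomp x; apply: ideal_sum => m _.
by apply: NNPP => nm; apply: all; exists m.
Qed.

(* A homogeneous element outside the ideal that is hit by an algebra map
   already has the weight of the image of some word. *)
Lemma surj_weight (f : F -> F) (b : I -> M) m e z : alg_mod P f ->
  (forall l, mhom (b l) (f (gn F l))) -> homog m e -> ~ Id e ->
  eqI P (f z) e -> exists s : seq I, \sum_(l <- s) b l = m.
Proof.
move=> [lf _ f1 fM] hb he ne fz; apply: NNPP => ns; apply: ne.
rewrite -he -(eqI_proj m fz).
elim/falg_ind: z {fz} => [|c s z IHz]; first by rewrite linear_zero // linear0.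
rewrite lf linearP /=; apply: idealD => //; apply: idealZ.
(* By multiplicativity the image of a word is homogeneous modulo the ideal, so words whose weight is
   not [m] contribute nothing to the component of weight [m]. *)
have hs : mhom (\sum_(l <- s) b l) (f (wd F s)).
  elim: s => [|l s IHs].
    rewrite big_nil wd_nil; apply: (mhom_eqI f1); apply: mhom_homog.
    by rewrite -wd_nil -wtw_nil; apply: homog_wd.
  by rewrite big_cons wd_cons; apply: (mhom_eqI (fM _ _)); apply: mhomM.
by apply: (mhom_proj hs); apply/eqP => em; apply: ns; exists s.
Qed.

End HomogeneousIdeal.
End Grading.

Lemma proj_swap (K : fieldType) (I : choiceType) (F : free_alg K I)
    (M M' : zmodType) (wt : I -> M) (wt' : I -> M') m m' (x : F) :
  proj wt m (proj wt' m' x) = proj wt' m' (proj wt m x).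
Proof.
elim/falg_ind: x => [|c s x IHx]; first by rewrite !linear0.
rewrite !(linearD, linearZ) /= IHx !proj_wd; congr (_ *: _ + _).
by case: ifP => h'; case: ifP => h; rewrite ?linear0 ?proj_wd ?h ?h'.
Qed.

(** * The Cartan form *)

Section Transcendental.
Variables (K : fieldType) (q : K).
Hypothesis q_tr : transcendental_over_Q q.

Lemma transcendental_neq0 : q != 0.
Proof.
have := @q_tr 'X; rewrite polyX_eq0 => /(_ isT); apply: contraNneq => ->.
have r0 : ratr (0 : rat) = 0 :> K by rewrite /ratr /= mul0r.
by apply/rootP; rewrite horner_coef0 coef_map_id0 // coefX.
Qed.

(** As [q] is not a root of any ['X^k - 1] with k > 0, it has infinite multiplicative order. Values
    of the Cartan form can therefore be read off from powers of [q]. *)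
Lemma transcendental_expz_inj : injective (fun m : int => q ^ m).
Proof.
have q0 := transcendental_neq0.
have pos k : (0 < k)%N -> q ^+ k != 1.
  move=> k0; have nz : 'X^k - 1 != 0 :> {poly rat} by rewrite monic_neq0 ?monicXnsubC.
  apply: contraNneq (q_tr nz) => qk; apply/rootP.
  have -> : map_poly (ratr : rat -> K) ('X^k - 1) = 'X^k - 1.
    have r0 : ratr (0 : rat) = 0 :> K by rewrite /ratr /= mul0r.
    apply/polyP => i; rewrite coef_map_id0 // !coefB coefXn coef1 coefXn coef1.
    (* Each coefficient is a difference of two bits, hence an integer, and on integers [ratr] is the
       canonical map. *)
    have e (b c : bool) : b%:R - c%:R = (b%:Z - c%:Z)%:~R :> rat by rewrite intrB.
    by rewrite e ratr_int intrB.
  by rewrite hornerD hornerN hornerXn hornerC qk subrr.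
move=> i j /= eqij; have eij : q ^ (i - j) = 1.
  by rewrite expfzDr // -invr_expz eqij mulfV // expfz_neq0.
apply/eqP; rewrite -subr_eq0; case: (i - j) eij => [[//|k]|k] /eqP.
  by rewrite -exprnP (negPf (pos _ _)).
by rewrite NegzE -exprnN invr_eq1 (negPf (pos _ _)).
Qed.
End Transcendental.

Section Cartan.
Variables (n : nat) (A : 'M[int]_n) (d : 'I_n -> nat).
Hypothesis cA : simple_cartan_matrix A.
Hypothesis dA : normalized_symmetrizer A d.

Definition ew (i : 'I_n) : 'rV[int]_n := delta_mx 0 i.

Lemma ewE i j : ew i 0 j = (j == i)%:R.
Proof. by rewrite mxE eqxx. Qed.

Lemma ew_ge0 i j : 0 <= ew i 0 j.
Proof. by rewrite ewE ler0n. Qed.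

Lemma ew_neq0 i : ew i != 0.
Proof. by apply/eqP => /rowP/(_ i); rewrite ewE eqxx mxE. Qed.

Lemma ew_inj : injective ew.
Proof.
by move=> i j /rowP/(_ i); rewrite !ewE eqxx; case: eqP.
Qed.

(** Simple roots are indecomposable among nonnegative integer vectors: the first nonzero summand
    vanishes off the coordinate [k] and already takes the whole entry 1 there. *)
Lemma sum_eq_ew (J : eqType) (s : seq J) (b : J -> 'rV[int]_n) k :
  (forall l j, 0 <= b l 0 j) -> \sum_(l <- s) b l = ew k ->
  exists2 l, l \in s & b l = ew k.
Proof.
move=> b0; elim: s => [|l s IHs].
  by rewrite big_nil => /esym/eqP; rewrite (negPf (ew_neq0 k)).
rewrite big_cons => e.
have r0 j : 0 <= (\sum_(l <- s) b l) 0 j by rewrite summxE sumr_ge0.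
have [bl0|bl_neq] := eqVneq (b l) 0.
  have [|l' l's bl'] := IHs; first by rewrite -e bl0 add0r.
  by exists l'; rewrite // in_cons l's orbT.
exists l; rewrite ?mem_head //.
have ej j : b l 0 j + (\sum_(l <- s) b l) 0 j = (j == k)%:R.
  by rewrite -ewE -e mxE.
have bj j : j != k -> b l 0 j = 0.
  by move=> /negPf jk; have := ej j; have := b0 l j; have := r0 j; rewrite jk; lia.
apply/rowP => j; rewrite ewE; case: eqP => [->|/eqP/bj//].
have := ej k; have := b0 l k; have := r0 k; rewrite eqxx.
suff : b l 0 k != 0 by lia.
apply: contra_neq bl_neq => blk; apply/rowP => i; rewrite mxE.
by have [->|/bj] := eqVneq i k.
Qed.

(** A choice [t] of preimages of the simple roots is injective, hence a permutation of the finite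
    index set; [s] is its inverse. *)
Lemma ew_perm (b : 'I_n -> 'rV[int]_n) : (forall k, exists i, b i = ew k) ->
  exists s : {perm 'I_n}, forall i, b i = ew (s i).
Proof.
move=> /fin_all_exists[t bt].
have t_inj : injective t by move=> i j tij; apply: ew_inj; rewrite -!bt tij.
exists (perm t_inj)^-1%g => i; rewrite -bt; congr b.
by rewrite -[t _](permE t_inj) permKV.
Qed.

(** The form on the root lattice given by (a_i, a_j) = d_i a_ij in the basis [ew] of simple roots.
    It is integer-valued, so it can serve as an exponent of [q]. *)
Definition bform (x y : 'rV[int]_n) : int :=
  (x *m (\matrix_(i, j) ((d i)%:Z * A i j)) *m y^T) 0 0.

Lemma bformDl x x' y : bform (x + x') y = bform x y + bform x' y.
Proof. by rewrite /bform !mulmxDl mxE. Qed.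
Lemma bformDr x y y' : bform x (y + y') = bform x y + bform x y'.
Proof. by rewrite /bform linearD mulmxDr mxE. Qed.
Lemma bform0l y : bform 0 y = 0.
Proof. by rewrite /bform !mul0mx mxE. Qed.
Lemma bform0r y : bform y 0 = 0.
Proof. by rewrite /bform trmx0 mulmx0 mxE. Qed.

Lemma bform_ewr x k : bform x (ew k) = \sum_i x 0 i * ((d i)%:Z * A i k).
Proof.
rewrite /bform trmx_delta -colE !mxE.
by apply: eq_bigr => i _; rewrite mxE.
Qed.

Lemma bform_ew i j : bform (ew i) (ew j) = (d i)%:Z * A i j.
Proof.
rewrite bform_ewr (bigD1 i) //= ewE eqxx mul1r big1 ?addr0 // => k /negPf nk.
by rewrite ewE nk mul0r.
Qed.

Lemma d_gt0 i : (0 < d i)%N.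
Proof. by case: dA. Qed.

Lemma bform_nondeg x y : (forall k, bform x (ew k) = bform y (ew k)) -> x = y.
Proof.
move=> exy; apply/eqP; rewrite -subr_eq0; apply/eqP.
set v := x - y.
have hv k : \sum_i v 0 i * ((d i)%:Z * A i k) = 0.
  have := exy k; rewrite !bform_ewr => e.
  under eq_bigr => i _ do rewrite !mxE mulrBl.
  by rewrite sumrB e subrr.
have [_ [d' [d'0 [_ pd]]]] := cA.
(* Positivity is known for a symmetrizer [d'] that may differ from [d]. Rescaling the coordinates by
   d_i / d'_i turns a kernel vector for [d] into one for [d']. *)
pose w : 'rV[rat]_n := \row_i ((v 0 i * (d i)%:Z)%:~R / (d' i)%:R).
have w0 : w *m symmetrized A d' = 0.
  apply/rowP => k; rewrite !mxE.
  transitivity ((\sum_i v 0 i * ((d i)%:Z * A i k))%:~R : rat); last by rewrite hv.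
  rewrite rmorph_sum; apply: eq_bigr => i _ /=; rewrite !mxE.
  have d'i : (d' i)%:R != 0 :> rat by rewrite pnatr_eq0 -lt0n.
  by rewrite !intrM -!pmulrn; field.
have [/eqP w_eq0|wn] := boolP (w == 0); last first.
  by have := pd _ wn; rewrite w0 mul0mx mxE ltxx.
apply/rowP => i; have := congr1 (fun z : 'rV[rat]_n => z 0 i) w_eq0.
rewrite !mxE => /eqP; rewrite mulf_eq0 invr_eq0 pnatr_eq0 eqn0Ngt d'0 orbF intr_eq0.
by rewrite mulf_eq0 => /orP[/eqP //|]; rewrite eqz_nat eqn0Ngt d_gt0.
Qed.

Lemma A_diag i : A i i = 2.
Proof. by case: cA => -[]. Qed.

(** The ratio d_(s j) / d_j is the same at both ends of an edge, hence constant because the diagram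
    is connected. Its n-th power is 1, since [s] only permutes the factors of the product of all
    d_j. The set [S] collects the nodes with the same ratio as [i]. *)
Lemma diagram_aut_sym s i : diagram_aut A s -> d (s i) = d i.
Proof.
move=> As; have [[n0 A2 _ A0 conn] _] := cA; have [dpos _ dsym] := dA.
pose S := [set j | d (s j) * d i == d j * d (s i)]%N.
have SE : S = setT.
  apply/eqP/negPn/negP => ST.
  have Si : i \in S by rewrite inE mulnC.
  have [|j [k [jS kS Ajk]]] := conn S _ ST; first by apply/set0Pn; exists i.
  case/negP: kS; move: jS; rewrite !inE => /eqP jS; apply/eqP.
  have Akj : A k j != 0 by apply: contraNneq Ajk => /A0/eqP.
  have e1 := dsym j k; have e2 := dsym (s j) (s k); rewrite !As in e2.
  have e3 : (d (s j) * d k = d j * d (s k))%N.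
    apply/eqP; rewrite -eqz_nat !PoszM -(inj_eq (mulIf Akj)).
    by rewrite -mulrA -e1 mulrCA e2 mulrA.
  apply/eqP; rewrite -(eqn_pmul2l (dpos j)) mulnA -e3 mulnAC jS.
  by rewrite mulnAC mulnA.
have prodE : (\prod_j (d (s j) * d i) = \prod_j (d j * d (s i)))%N.
  by apply: eq_bigr => j _; apply/eqP; have := in_setT j; rewrite -SE inE.
have reE : (\prod_j d (s j) = \prod_j d j)%N.
  by rewrite [RHS](reindex_inj (@perm_inj _ s)).
move: prodE; rewrite !big_split /= reE.
move/eqP; rewrite eqn_pmul2l ?prodn_gt0 // !prod_nat_const card_ord eqn_exp2r //.
by move/eqP.
Qed.

(** The values (a_i, a_i) = 2 d_i show that [s] preserves [d]; then d_i cancels from d_i a_ij. *)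
Lemma bform_diagram (s : {perm 'I_n}) :
  (forall i j, bform (ew (s i)) (ew (s j)) = bform (ew i) (ew j)) ->
  diagram_aut A s.
Proof.
move=> bs; have ds i : d (s i) = d i.
  by have := bs i i; rewrite !bform_ew !A_diag; lia.
move=> i j; have := bs i j; rewrite !bform_ew ds => /mulfI; apply.
by rewrite eqz_nat -lt0n d_gt0.
Qed.

End Cartan.

(** * Automorphisms permuting the generators up to scalars *)

Section Automorphisms.
Variables (K : fieldType) (I : choiceType) (F : free_alg K I) (T : tens_sq F).
Local Notation W := {fmonom I}.

Definition ton : T := pt T (@fmone I, @fmone I).

(** [cop], [tbr] and [bialg_auto] transcribe [coprod], [tbraid] and [bialg_aut] to the abstract
    interface, and are convertible with them in the concrete model. *)
Definition cop (chi : W -> W -> K) (D : I -> T) : F -> T :=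
  lin (fun u => foldr (fun i acc => tmu chi (D i) acc) ton (fmonom_val u)).
HB.instance Definition _ chi D := GRing.Linear.on (cop chi D).

Definition tbr (chi : W -> W -> K) : T -> T :=
  tlin (fun p => upt T (chi p.1 p.2) (p.2, p.1)).
HB.instance Definition _ chi := GRing.Linear.on (tbr chi).

Definition linear_map (f : F -> F) : Prop :=
  forall (a : K) (x y : F), f (a *: x + y) = a *: f x + f y.

Definition bialg_auto (P : F -> Prop) (chi : W -> W -> K) (D : I -> T)
    (eps : F -> K) (f : F -> F) : Prop :=
  [/\ linear_map f,
      forall x, ideal P x -> ideal P (f x),
      exists g, [/\ linear_map g,
                    forall x, ideal P x -> ideal P (g x),
                    forall x, ideal P (g (f x) - x) &
                    forall x, ideal P (f (g x) - x)],
      forall x y, ideal P (f (x * y) - f x * f y) &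
      ideal P (f 1 - 1)]
  /\ (forall x, tideal P (tm T f f (cop chi D x) - cop chi D (f x)))
  /\ (forall x, eps (f x) = eps x).

Lemma bialg_auto_alg_mod P chi D eps f : bialg_auto P chi D eps f -> alg_mod P f.
Proof. by case=> -[]. Qed.

Lemma bialg_auto_ideal P chi D eps f x : bialg_auto P chi D eps f ->
  ideal P (f x) -> ideal P x.
Proof.
move=> [[_ _ [g [_ Ig gf _]] _ _] _] /Ig Igf.
by have := idealB Igf (gf x); rewrite subKr.
Qed.

Lemma bialg_auto_surj P chi D eps f x : bialg_auto P chi D eps f ->
  exists y, eqI P (f y) x.
Proof. by move=> [[_ _ [g [_ _ _ fg]] _ _] _]; exists (g x); apply: fg. Qed.

Lemma cop_gnM chi D l x : cop chi D (gn F l * x) = tmu chi (D l) (cop chi D x).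
Proof.
elim/falg_ind: x => [|c s x IHx]; first by rewrite mulr0 !linear0.
rewrite mulrDr -scalerAr -wd_cons !linearP /= IHx; congr (_ *: _ + _).
by rewrite /cop !lin_bs.
Qed.

Lemma cop1 chi D : cop chi D 1 = ton.
Proof. by rewrite -wd_nil /cop lin_bs. Qed.

(** * Substitutions of generators by multiples of generators *)

Section Monomial.
Variables (c : I -> K) (p : I -> I).

Definition mono : F -> F := fext F (fun l => c l *: gn F (p l)).
HB.instance Definition _ := GRing.LRMorphism.on mono.

Lemma mono_gn l : mono (gn F l) = c l *: gn F (p l).
Proof. exact: fext_gn. Qed.

Lemma mono_wd s : mono (wd F s) = (\prod_(l <- s) c l) *: wd F (map p s).
Proof.
elim: s => [|l s IHs]; first by rewrite big_nil scale1r !wd_nil rmorph1.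
rewrite wd_cons rmorphM /= mono_gn IHs big_cons wd_cons.
by rewrite -scalerAl -scalerAr scalerA.
Qed.

Lemma mono_tm_pt s t : tm T mono mono (pt T (FMonom s, FMonom t)) =
  ((\prod_(l <- s) c l) * (\prod_(l <- t) c l)) *:
    pt T (FMonom (map p s), FMonom (map p t)).
Proof.
by rewrite /tm tlin_pt !mono_wd tenZl linearZ /= scalerA ten_bs.
Qed.

Variable chi : W -> W -> K.
Hypothesis chi_p : forall s t,
  chi (FMonom (map p s)) (FMonom (map p t)) = chi (FMonom s) (FMonom t).

Lemma mono_tmu x y : tm T mono mono (tmu chi x y) =
  tmu chi (tm T mono mono x) (tm T mono mono y).
Proof.
elim/pt_ind: x => [|e [[s] [t]] x IHx]; first by rewrite linear0 !tmu0l linear0.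
rewrite !(tmuDl, tmuZl, linearD, linearZ) /= IHx.
congr (_ *: _ + _); elim/pt_ind: y {IHx} => [|a [[s'] [t']] y IHy].
  by rewrite !linear0.
rewrite !linearP /= IHy; congr (_ *: _ + _).
rewrite tmu_pt !mono_tm_pt linearZ /= !fmmulE mono_tm_pt tmuZl [tmu _ _ (_ *: _)]linearZ /= tmu_pt /=.
rewrite chi_p !fmmulE !map_cat !big_cat /= !scalerA; congr (_ *: _).
by ring.
Qed.

Lemma mono_tbr x : tm T mono mono (tbr chi x) = tbr chi (tm T mono mono x).
Proof.
elim/pt_ind: x => [|e [[s] [t]] x IHx]; first by rewrite !linear0.
rewrite !linearP /= IHx; congr (_ *: _ + _).
rewrite mono_tm_pt linearZ /= /tbr !tlin_pt !uptE /= linearZ /= mono_tm_pt chi_p.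
by rewrite !scalerA; congr (_ *: _); ring.
Qed.

Variable D : I -> T.
Hypothesis D_p : forall l, tm T mono mono (D l) = c l *: D (p l).

Lemma mono_cop x : tm T mono mono (cop chi D x) = cop chi D (mono x).
Proof.
elim/falg_ind: x => [|e s x IHx]; first by rewrite !linear0.
rewrite !linearP /= IHx; congr (_ *: _ + _).
elim: s => [|l s IHs].
  rewrite wd_nil rmorph1 cop1 /ton !fmoneE mono_tm_pt !big_nil mulr1 scale1r.
  by [].
rewrite wd_cons cop_gnM mono_tmu IHs D_p tmuZl rmorphM /= mono_gn.
by rewrite -scalerAl linearZ /= cop_gnM.
Qed.

End Monomial.

(** The inverse is the monomial substitution with data [c'] and [p']. All identities hold exactly in
    the free algebra; the relations enter only through the stability of the ideal. *)
Lemma mono_bialg_auto P chi D eps c p c' p' :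
  (forall l, c l * c' (p l) = 1) -> (forall l, c' l * c (p' l) = 1) ->
  cancel p p' -> cancel p' p ->
  (forall x, P x -> ideal P (mono c p x)) ->
  (forall x, P x -> ideal P (mono c' p' x)) ->
  (forall s t,
     chi (FMonom (map p s)) (FMonom (map p t)) = chi (FMonom s) (FMonom t)) ->
  (forall l, tm T (mono c p) (mono c p) (D l) = c l *: D (p l)) ->
  (forall x, eps (mono c p x) = eps x) ->
  bialg_auto P chi D eps (mono c p).
Proof.
move=> cc' c'c pK p'K Pp Pp' chi_p D_p eps_p.
have inv b b' r r' : (forall l, b l * b' (r l) = 1) -> cancel r r' ->
    forall x, mono b' r' (mono b r x) = x.
  move=> bb' rK; apply: (@lrmorph_falg_ext _ _ _ F (mono b' r' \o mono b r) idfun).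
  by move=> l /=; rewrite mono_gn linearZ /= mono_gn scalerA bb' rK scale1r.
split; [split|split=> //].
- exact: linearP.
- exact: ideal_preserved.
- exists (mono c' p'); split; first exact: linearP.
  + exact: ideal_preserved.
  + by move=> x; rewrite inv // subrr; apply: ideal0.
  + by move=> x; rewrite inv // subrr; apply: ideal0.
- by move=> x y; rewrite rmorphM subrr; apply: ideal0.
- by rewrite rmorph1 subrr; apply: ideal0.
- by move=> x; rewrite mono_cop // subrr; apply: tideal0.
Qed.

Lemma mono_comp c p c' p' x :
  mono c p (mono c' p' x) = mono (fun l => c' l * c (p' l)) (p \o p') x.
Proof.
apply: (@lrmorph_falg_ext _ _ _ F (mono c p \o mono c' p') (mono _ _)) => l /=.
by rewrite !mono_gn linearZ /= mono_gn scalerA.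
Qed.

Lemma mono_eq c p c' p' x : (forall l, c l = c' l) -> p =1 p' ->
  mono c p x = mono c' p' x.
Proof.
move=> ec ep; apply: (@lrmorph_falg_ext _ _ _ F (mono c p) (mono c' p')) => l /=.
by rewrite !mono_gn ec ep.
Qed.

End Automorphisms.
Arguments mono {K I} F c p _.

(** * Serre elements under morphisms, rescaling and permutation *)

Section Serre.
Variables (K : fieldType) (q : K) (n : nat) (A : 'M[int]_n) (d : 'I_n -> nat).

Lemma serre_morph (B C : algType K) (f : {lrmorphism B -> C}) (E : 'I_n -> B) i j :
  f (serre q A d E i j) = serre q A d (fun k => f (E k)) i j.
Proof.
rewrite /serre linear_sum; apply: eq_bigr => v _.
by rewrite linearZ /= !rmorphM !rmorphXn rmorphN.
Qed.

(** Every term contains 1 - a_ij factors with index [i] and one with index [j], so the scalars come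
    out as the common factor c_i^(1 - a_ij) c_j. *)
Lemma serre_scale (B : algType K) (E : 'I_n -> B) (c : 'I_n -> K)
    (s : {perm 'I_n}) i j : diagram_aut A s -> (forall k, d (s k) = d k) ->
  exists e, serre q A d (fun k => c k *: E (s k)) i j =
            e *: serre q A d E (s i) (s j).
Proof.
move=> As ds; exists (c i ^+ `|(1 - A i j)%R|%N * c j); rewrite /serre As ds scaler_sumr.
apply: eq_bigr => v _; rewrite [RHS]scalerA [_ * qbinom _ _ _]mulrC -[RHS]scalerA.
congr (_ *: _).
set m := absz _; have vm : (v <= m)%N by rewrite -ltnS.
rewrite /= -scalerN !exprZn -!scalerAl -!scalerAr -!scalerAl !scalerA; congr (_ *: _).
by rewrite -[in RHS](subnK vm) exprD; ring.
Qed.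

(** Since 1 - a_ij > 0, both [E i] and [E j] occur in every term. *)
Lemma serre_eq0 (B : algType K) (E : 'I_n -> B) i j :
  A i j <= 0 -> E i = 0 \/ E j = 0 -> serre q A d E i j = 0.
Proof.
move=> Aij E0; rewrite /serre big1 // => v _.
case: E0 => ->; last by rewrite mulr0 mul0r scaler0.
rewrite oppr0; set m := absz _; have m0 : (0 < m)%N by rewrite /m; lia.
have [->|v0] := posnP (v : nat); first by rewrite subn0 expr0n gtn_eqF // !mul0r scaler0.
by rewrite [0 ^+ v]expr0n gtn_eqF // mulr0 scaler0.
Qed.

End Serre.

(** * Automorphisms of [U_q^+] *)

Section SerreHomog.
Variables (K : fieldType) (q : K) (n : nat) (A : 'M[int]_n) (d : 'I_n -> nat).

Lemma serre_homog (I : choiceType) (F : free_alg K I) (M : zmodType)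
    (wt : I -> M) (E : 'I_n -> F) (m : 'I_n -> M) i j :
  (forall k, homog wt (m k) (E k)) ->
  homog wt (m i *+ absz (1 - A i j) + m j) (serre q A d E i j).
Proof.
move=> hE; apply: homog_sum => v _; apply: homogZ.
set r := absz _; have vr : (v <= r)%N by rewrite -ltnS.
have -> : m i *+ r + m j = m i *+ (r - v) + m j + m i *+ v.
  by rewrite addrAC -mulrnDr subnK.
apply: homogM; last by apply/homogX/homogN.
by apply: homogM => //; apply: homogX.
Qed.

Lemma diagram_autV (s : {perm 'I_n}) : diagram_aut A s -> diagram_aut A s^-1%g.
Proof. by move=> As i j; rewrite -{2}[i](permKV s) -{2}[j](permKV s) As. Qed.

End SerreHomog.

Section Plus.
Variables (K : fieldType) (q : K) (n : nat) (A : 'M[int]_n) (d : 'I_n -> nat).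
Variables (F : free_alg K 'I_n) (T : tens_sq F).
Hypothesis q_tr : transcendental_over_Q q.
Hypothesis cA : simple_cartan_matrix A.
Hypothesis dA : normalized_symmetrizer A d.
(** The counit is a parameter known by its values on words, because the concrete coefficient of the
    empty word is not a [lin] by conversion. *)
Variable eps : F -> K.
Hypothesis eps_linear : linear (eps : F -> K^o).
Hypothesis eps_wd : forall s, eps (wd F s) = (s == [::])%:R.

Definition relp (x : F) : Prop :=
  exists i j, i != j /\ x = serre q A d (gn F) i j.

Definition Dp (i : 'I_n) : T := ten T (gn F i) 1 + ten T 1 (gn F i).

Local Notation chi := (chi_plus q A d).
Local Notation Id := (ideal relp).
Local Notation deg := (wtw (@ew n)).
Local Notation bf := (bform A d).

Definition autp (f : F -> F) : Prop :=
  bialg_auto relp chi Dp eps f /\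
  (forall t, tideal relp (tm T f f (tbr chi t) - tbr chi (tm T f f t))).

Definition phip (alpha : 'I_n -> K) (s : {perm 'I_n}) : F -> F :=
  mono F (fun i => alpha (s i)) s.

Lemma A_le0 i j : i != j -> A i j <= 0.
Proof. by case: cA => -[_ _ Anp _ _] _ /Anp. Qed.

Lemma relp_homog r : relp r -> exists m, homog (@ew n) m r.
Proof.
move=> [i [j [_ ->]]]; eexists; apply: serre_homog => k; exact: homog_gen.
Qed.

Lemma chi_plusE s t : chi (FMonom s) (FMonom t) = q ^ bf (deg s) (deg t).
Proof.
have q0 := transcendental_neq0 q_tr.
rewrite /chi_plus /=; elim: s => [|a s IHs].
  by rewrite big_nil wtw_nil bform0l.
rewrite big_cons IHs wtw_cons bformDl expfzDr //; congr (_ * _).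
elim: t {IHs} => [|b t IHt]; first by rewrite big_nil wtw_nil bform0r.
by rewrite big_cons IHt wtw_cons bformDr expfzDr // bform_ew.
Qed.

(** The coefficient of the letter [k], realized as a matrix entry of the algebra map sending E_k to
    a nilpotent 2 x 2 matrix and the other generators to 0. Its vanishing on the ideal then needs
    checking on the relations only. *)
Definition lamk (k : 'I_n) (x : F) : K^o :=
  fext F (fun l : 'I_n => if l == k then delta_mx 0 1 else 0 : 'M[K]_2) x 0 1.

Fact lamk_linear k : linear (lamk k).
Proof. by move=> a x y; rewrite /lamk linearP !mxE. Qed.
HB.instance Definition _ k := GRing.isLinear.Build K F K^o *:%R (lamk k)
  (lamk_linear k).

Lemma lamk_wd k s : lamk k (wd F s) = (s == [:: k])%:R.
Proof.
rewrite /lamk fext_wd; case: s => [|a [|b s]].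
- by rewrite big_nil mxE.
- by rewrite big_seq1 eqseq_cons andbT; case: eqP; rewrite mxE.
(* Words of length at least two are sent to 0, because [delta_mx 0 1] has square 0. *)
rewrite !big_cons mulrA [X in X * _](_ : _ = 0) ?mul0r ?mxE ?eqseq_cons ?andbF //.
case: eqP => _; last by rewrite mul0r.
by case: eqP => _; rewrite ?mulr0 // -mulmxE mul_delta_mx_0.
Qed.

Lemma lamk_gn k l : lamk k (gn F l) = (l == k)%:R.
Proof. by rewrite -wd_gen lamk_wd eqseq_cons andbT. Qed.

(** Of two distinct letters [i] and [j], at least one differs from [k] and goes to 0, and both occur
    in every term of the Serre relation. *)
Lemma lamk_ideal k x : Id x -> lamk k x = 0.
Proof.
move=> Ix; rewrite /lamk (ideal_ker _ Ix) ?mxE // => _ [i [j [ij ->]]].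
rewrite serre_morph; apply: serre_eq0; first exact: A_le0.
rewrite /= !fext_gn; have [ik|] := eqVneq i k; last by left.
by right; rewrite -ik eq_sym (negPf ij).
Qed.

Lemma lamk_eqI k x y : eqI relp x y -> lamk k x = lamk k y.
Proof. by move=> /(lamk_ideal k)/eqP; rewrite linearB subr_eq0 => /eqP. Qed.

Lemma gn_nonideal k : ~ Id (gn F k).
Proof.
by move=> /(lamk_ideal k)/eqP; rewrite lamk_gn eqxx oner_eq0.
Qed.

(** The length of a word is the sum of the coordinates of its weight, so the only word of weight a_k
    is the letter [k]. *)
Lemma proj_ew k (x : F) : exists c, proj (@ew n) (ew k) x = c *: gn F k.
Proof.
elim/falg_ind: x => [|c s x [e IHx]]; first by exists 0; rewrite linear0 scale0r.
rewrite linearP /= IHx proj_wd; have [sk|_] := eqVneq; last first.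
  by exists e; rewrite scaler0 add0r.
suff -> : s = [:: k] by exists (c + e); rewrite wd_gen scalerDl.
case: s sk => [|a s]; first by rewrite wtw_nil => /esym/eqP; rewrite (negPf (ew_neq0 k)).
have sum_deg t : \sum_j deg t 0 j = (size t)%:Z.
  elim: t => [|b t IHt]; first by rewrite wtw_nil big1 // => j _; rewrite mxE.
  rewrite wtw_cons /= -[(size t).+1]add1n PoszD -IHt.
  under eq_bigr do rewrite mxE; rewrite big_split /=; congr (_ + _).
  by rewrite (bigD1 b) //= ewE eqxx big1 // => j /negPf nj; rewrite ewE nj.
move=> sk; have : (size (a :: s))%:Z = (size [:: k])%:Z.
  by rewrite -!sum_deg sk wtw_cons wtw_nil addr0.
move=> [] /size0nil s0.
by move: sk; rewrite s0 wtw_cons wtw_nil addr0 => /ew_inj->.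
Qed.

(** Multiplication of each component of weight b by q^(b, a_k): the scalar produced by braiding that
    component with E_k. *)
Definition twist (k : 'I_n) : F -> F :=
  lin (fun u => q ^ bf (deg (fmonom_val u)) (ew k) *: bs F u).
HB.instance Definition _ k := GRing.Linear.on (twist k).

Lemma proj_twist b k x :
  proj (@ew n) b (twist k x) = q ^ bf b (ew k) *: proj (@ew n) b x.
Proof.
elim/falg_ind: x => [|c s x IHx]; first by rewrite !linear0.
rewrite !linearP /= IHx; congr (_ *: _ + _).
rewrite /twist lin_bs /= linearZ /= !proj_wd.
by case: eqP => [->//|_]; rewrite !scaler0.
Qed.

(** The scalar [t] of the contracted braiding identity: braiding E_i with a word [w] gives chi(E_i,
    w), and the contraction then takes the coefficient of E_k in [f] of [w]. *)
Definition bcoef (f : F -> F) (i k : 'I_n) : F -> K^o :=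
  lin (fun w => chi (fmu i) w * lamk k (f (bs F w)) : K^o).
HB.instance Definition _ f i k := GRing.Linear.on (bcoef f i k).

(* Compatibility with the braiding on [E_i (x) z], contracted with the
   functional "coefficient of [E_k]" in the first factor. *)
Lemma braid_eq f i k z : autp f ->
  eqI relp (bcoef f i k z *: f (gn F i)) (lamk k (f z) *: twist k (f (gn F i))).
Proof.
move=> [f_auto fbr]; have [lf _ _ _] := bialg_auto_alg_mod f_auto.
have := tideal_slicel (@lamk_ideal k) (fbr (ten T (gn F i) z)).
rewrite linearB /=.
(* Braiding first and applying [f] afterwards leaves [f (gn F i)] in the uncontracted factor. *)
have -> : slicel (lamk k) (tm T f f (tbr chi (ten T (gn F i) z))) =
    bcoef f i k z *: f (gn F i).
  elim/bs_ind: z => [|c w z IHz]; first by rewrite !linear0 scale0r.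
  rewrite !linearP /= IHz scalerDl -scalerA; congr (_ *: _ + _).
  rewrite ten_bs /tbr tlin_pt uptE linearZ linearZ /= /tm tlin_pt slicel_ten.
  by rewrite scalerA /bcoef lin_bs.
(* Applying [f] first, only the one-letter word [k] of f(z) survives the contraction, and braiding
   with it is [twist k]. *)
suff -> : slicel (lamk k) (tbr chi (tm T f f (ten T (gn F i) z))) =
    lamk k (f z) *: twist k (f (gn F i)) by [].
rewrite tm_ten //; move: (f _) (f z) => {z} x y.
elim/falg_ind: x => [|c s x IHx]; first by rewrite ten0l !linear0.
rewrite tenDl tenZl !linearP /= IHx; congr (_ *: _ + _).
elim/falg_ind: y {IHx} => [|e t y IHy]; first by rewrite !linear0 scale0r.
rewrite !linearP /= IHy scalerDl -scalerA; congr (_ *: _ + _).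
rewrite ten_bs /tbr tlin_pt uptE linearZ /= /slicel tlin_pt /= -/(wd F t) lamk_wd.
rewrite chi_plusE /twist lin_bs /= scalerA; case: eqP => [->|_].
  by rewrite mulr1 scale1r wtw_cons wtw_nil addr0.
by rewrite mulr0 !scale0r.
Qed.

(** Projected on weight [b], the braiding identity says that the difference of the two scalars times
    a component outside the ideal lies in the ideal. *)
Lemma autp_weight f i k z b : autp f ->
  ~ Id (proj (@ew n) b (f (gn F i))) ->
  bcoef f i k z = (lamk k (f z) : K) * q ^ bf b (ew k) :> K.
Proof.
move=> fa; have := eqI_proj relp_homog b (braid_eq i k z fa).
rewrite !linearZ /= proj_twist scalerA /eqI -scalerBl => Ib nb.
apply/eqP; rewrite -subr_eq0; apply/negP => /negP nz; apply: nb.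
exact: idealZK nz Ib.
Qed.

(** * The shape of an automorphism of [U_q^+] *)

Lemma autp_form f : autp f -> exists alpha s,
  [/\ forall i, alpha i != 0, diagram_aut A s &
      forall i, eqI relp (f (gn F i)) (alpha (s i) *: gn F (s i))].
Proof.
move=> fa; have [f_auto _] := fa; have fm := bialg_auto_alg_mod f_auto.
have q0 := transcendental_neq0 q_tr; have q_inj := transcendental_expz_inj q_tr.
have fnz i : ~ Id (f (gn F i)).
  by move=> /(bialg_auto_ideal f_auto); apply: gn_nonideal.
have [b hb] : exists b : 'I_n -> 'rV[int]_n, forall i,
    mhom (@ew n) relp (b i) (f (gn F i)) /\ (forall j, 0 <= b i 0 j).
  apply: (fin_all_exists (P := fun i (b : 'rV[int]_n) =>
    mhom (@ew n) relp b (f (gn F i)) /\ forall j, 0 <= b 0 j)) => i.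
  have [b nb] := nonideal_proj (@ew n) (fnz i).
  exists b; split; last first.
    move=> j; have [|s <-] := @proj_neq0 _ _ _ _ (@ew n) b (f (gn F i)).
      by move=> p0; apply: nb; rewrite p0; apply: ideal0.
    by rewrite /wtw summxE sumr_ge0 // => l _; apply: ew_ge0.
  (* Two weights [b] and [b'] that both occur pair equally with each simple root a_k: take [z] with
     f(z) = E_k and compare the two values of the same scalar [bcoef f i k z]. *)
  apply: mhomW => b' bb'; apply: NNPP => nb'; case/eqP: bb'.
  apply: (bform_nondeg cA dA) => k; have [z fz] := bialg_auto_surj (gn F k) f_auto.
  have lz : lamk k (f z) = 1 by rewrite (lamk_eqI k fz) lamk_gn eqxx.
  apply: q_inj; have := autp_weight k z fa nb; rewrite (autp_weight k z fa nb').
  by rewrite lz !mul1r.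
have [s hs] : exists s : {perm 'I_n}, forall i, b i = ew (s i).
  apply: ew_perm => k; have [z fz] := bialg_auto_surj (gn F k) f_auto.
  have hl l := (hb l).1.
  have [w hw] := surj_weight relp_homog fm hl (homog_gen F (@ew n) k) (@gn_nonideal k) fz.
  by have [l _ bl] := sum_eq_ew (fun l => (hb l).2) hw; exists l.
have mh i : mhom (@ew n) relp (ew (s i)) (f (gn F i)) by rewrite -hs; case: (hb i).
have [a ha] : exists a : 'I_n -> K, forall i,
    eqI relp (f (gn F i)) (a i *: gn F (s i)).
  apply: (fin_all_exists (P := fun i (c : K) =>
    eqI relp (f (gn F i)) (c *: gn F (s i)))) => i.
  have [c hc] := proj_ew (s i) (f (gn F i)).
  by exists c; rewrite -hc; apply: mh.
have a0 i : a i != 0.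
  apply/eqP => ai; apply: (fnz i); rewrite (ha i) ai scale0r; exact: ideal0.
(* The scalars are indexed by the target generator, whence the reindexing by the inverse of [s]. *)
exists (fun k => a (s^-1%g k)), s; split=> [i|//|i]; last by rewrite permK.
  exact: a0.
apply: (bform_diagram cA dA) => i j; apply: q_inj.
have nb : ~ Id (proj (@ew n) (ew (s i)) (f (gn F i))).
  by have e : eqI relp _ _ := mh i; rewrite -e; apply: fnz.
(* For z = E_j and k = s j the scalar [bcoef] is a_j q^(a_i, a_j), so cancelling [a j] compares the
   form at (i, j) and at (s i, s j). *)
have := autp_weight (s j) (gn F j) fa nb.
rewrite /bcoef lin_bs (lamk_eqI _ (ha j)) linearZ /= lamk_gn eqxx.
have -> : chi (fmu i) (fmu j) = q ^ bf (ew i) (ew j).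
  by rewrite !fmuE chi_plusE !wtw_cons !wtw_nil !addr0.
rewrite -[_ *: _]/(a j * 1) mulr1 mulrC => /(mulfI (a0 j)) //.
Qed.

Lemma relp_mono c (s : {perm 'I_n}) x : diagram_aut A s ->
  relp x -> Id (mono F c s x).
Proof.
move=> As [i [j [ij ->]]]; rewrite serre_morph.
have ds k : d (s k) = d k := diagram_aut_sym cA dA k As.
have [e] := serre_scale q (gn F) c i j As ds.
have -> : serre q A d (fun k => mono F c s (gn F k)) i j =
    serre q A d (fun k => c k *: gn F (s k)) i j.
  by apply: eq_bigr => v _; rewrite !mono_gn.
move=> ->; apply/idealZ/ideal_gen; exists (s i), (s j).
by rewrite (inj_eq perm_inj).
Qed.

Lemma deg_map (s : {perm 'I_n}) w w' : diagram_aut A s ->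
  bf (deg (map s w)) (deg (map s w')) = bf (deg w) (deg w').
Proof.
move=> As; elim: w => [|a w IHw]; first by rewrite wtw_nil !bform0l.
rewrite /= !wtw_cons !bformDl IHw; congr (_ + _).
elim: w' {IHw} => [|b w' IHw]; first by rewrite wtw_nil !bform0r.
by rewrite /= !wtw_cons !bformDr IHw !bform_ew As (diagram_aut_sym cA dA).
Qed.

Lemma phip_aut alpha s : (forall i, alpha i != 0) -> diagram_aut A s ->
  autp (phip alpha s).
Proof.
move=> a0 As.
have chi_s w w' : chi (FMonom (map s w)) (FMonom (map s w')) = chi (FMonom w) (FMonom w').
  by rewrite !chi_plusE deg_map.
split; last by move=> t; rewrite mono_tbr // subrr; apply: tideal0.
apply: (@mono_bialg_auto _ _ _ _ _ _ _ _ _ _ (fun i => (alpha i)^-1) (s^-1)%g).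
- by move=> l; rewrite mulfV.
- by move=> l; rewrite permKV mulVf.
- exact: permK.
- exact: permKV.
- by move=> x; apply: relp_mono.
- by move=> x; apply/relp_mono/diagram_autV.
- exact: chi_s.
- move=> l; rewrite linearD /= !tm_ten ?rmorph1 ?mono_gn; try exact: linearP.
  by rewrite tenZl linearZ /= -scalerDr.
- apply: (@linear_bs_ext _ _ F K^o) => [a x y|a x y|u].
  + by rewrite linearP; apply: eps_linear.
  + exact: eps_linear.
  rewrite bs_wd mono_wd (linear_scale _ _ eps_linear) !eps_wd.
  case: (fmonom_val u) => [|l w]; first by rewrite big_nil scale1r.
  exact: mulr0.
Qed.

Theorem autp_torus_diag : torus_diag_iso A autp (eqI relp) phip.
Proof.
split.
- by move=> alpha s [a0 As]; apply: phip_aut.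
- move=> f fa; have [alpha [s [a0 As hf]]] := autp_form fa.
  exists alpha, s; split=> //; apply: alg_mod_ext.
  + exact: bialg_auto_alg_mod fa.1.
  + exact: bialg_auto_alg_mod (phip_aut a0 As).1.
  + by move=> l; rewrite /phip mono_gn; apply: hf.
- move=> alpha s beta t [a0 _] [b0 _] e.
  (* The coefficient of E_(s i) in the first image of E_i is the nonzero [alpha (s i)]; in the
     second image it is 0 unless t i = s i. *)
  have est i : s i = t i /\ alpha (s i) = beta (t i).
    have := lamk_eqI (s i) (e (gn F i)); rewrite /phip !mono_gn !linearZ /= !lamk_gn eqxx.
    have [<-|_] := eqVneq (t i) (s i).
      by rewrite -![_ *: _]/(_ * _) !mulr1.
    by rewrite -![_ *: _]/(_ * _) mulr1 mulr0 => /eqP; rewrite (negPf (a0 _)).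
  have st : s = t by apply/permP => i; case: (est i).
  split=> // k; have [_] := est (s^-1%g k).
  by rewrite -st permKV.
- move=> alpha s beta t _ _ x; rewrite /phip mono_comp.
  (* Products of permutations are read from left to right: [t * s] applies [t] first. *)
  rewrite (@mono_eq _ _ _ _ _ (fun i => alpha ((t * s)%g i) *
    beta ((s^-1)%g ((t * s)%g i))) (t * s)%g) //.
  + by move=> l; rewrite permM permK mulrC.
  + by move=> l; rewrite permM.
Qed.

End Plus.

(** * Automorphisms of [U_q(b^+)] *)

Section Borel.
Variables (K : fieldType) (q : K) (n : nat) (A : 'M[int]_n) (d : 'I_n -> nat).
Local Notation bgen := (bgen n).
Variables (F : free_alg K bgen) (T : tens_sq F).
Hypothesis q_tr : transcendental_over_Q q.
Hypothesis cA : simple_cartan_matrix A.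
Hypothesis dA : normalized_symmetrizer A d.

Definition lE (i : 'I_n) : bgen := inl (inl i).
Definition lK (i : 'I_n) : bgen := inl (inr i).
Definition lKi (i : 'I_n) : bgen := inr i.

Definition gE (i : 'I_n) : F := gn F (inl (inl i) : bgen).
Definition gK (i : 'I_n) : F := gn F (inl (inr i) : bgen).
Definition gKi (i : 'I_n) : F := gn F (inr i : bgen).

Definition relb (x : F) : Prop :=
  (exists i j, i != j /\ x = serre q A d gE i j) \/
  (exists i, x = gK i * gKi i - 1) \/
  (exists i, x = gKi i * gK i - 1) \/
  (exists i j, x = gK i * gK j - gK j * gK i) \/
  (exists i j, x = gK i * gE j - q ^ ((d i)%:Z * A i j) *: (gE j * gK i)).

Definition Db (l : bgen) : T :=
  match l with
  | inl (inl i) => ten T (gE i) 1 + ten T (gK i) (gE i)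
  | inl (inr i) => ten T (gK i) (gK i)
  | inr i => ten T (gKi i) (gKi i)
  end.

Definition epsb : F -> K^o :=
  fext F (fun l : bgen => match l with inl (inl _) => 0 | _ => 1 end : K^o).
HB.instance Definition _ := GRing.LRMorphism.on epsb.

Definition Sb : F -> F :=
  lin (fun u => \prod_(l <- rev (fmonom_val u)) match l with
           | inl (inl i) => - (gKi i * gE i)
           | inl (inr i) => gKi i
           | inr i => gK i
           end).

Local Notation chi := (@chi_b K n).
Local Notation Id := (ideal relb).
Local Notation bf := (bform A d).

Definition autb (f : F -> F) : Prop :=
  bialg_auto relb chi Db epsb f /\ (forall x, Id (Sb (f x) - f (Sb x))).

Definition phib (alpha : 'I_n -> K) (s : {perm 'I_n}) : F -> F :=
  fext F (fun l : bgen => match l with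
        | inl (inl i) => alpha (s i) *: gE (s i)
        | inl (inr i) => gK (s i)
        | inr i => gKi (s i)
        end).

(** * Two gradings of [U_q(b^+)] and contractions of its coproduct *)

Definition wE (l : bgen) : 'rV[int]_n := if l is inl (inl i) then ew i else 0.
Definition wK (l : bgen) : 'rV[int]_n :=
  match l with inl (inl _) => 0 | inl (inr i) => ew i | inr i => - ew i end.
(** Gives E_i and K_i the same degree. It records the K-content left by a word in the first tensor
    factor, where E_i contributes K_i through the term K_i (x) E_i. *)
Definition wEK (l : bgen) : 'rV[int]_n := wE l + wK l.

(** The Serre and commutation relations have the same letters in all their terms; the inverse
    relations have weight 0 as soon as K_i and its inverse have opposite weights. *)
Lemma relb_homog (wt : bgen -> 'rV[int]_n) r :
  (forall i, wt (lKi i) = - wt (lK i)) -> relb r -> exists m, homog wt m r.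
Proof.
move=> wtV.
have hE i : homog wt (wt (lE i)) (gE i) by exact: homog_gen.
have hK i : homog wt (wt (lK i)) (gK i) by exact: homog_gen.
have hV i : homog wt (- wt (lK i)) (gKi i) by rewrite -wtV; exact: homog_gen.
have h1 : homog wt 0 (-1 : F).
  by apply: homogN; rewrite -wd_nil -(wtw_nil wt); apply: homog_wd.
case=> [[i [j [_ ->]]]|[[i ->]|[[i ->]|[[i [j ->]]|[i [j ->]]]]]].
- by eexists; apply: serre_homog => k; apply: hE.
- by exists 0; apply: homogD => //; rewrite -(subrr (wt (lK i))); apply: homogM.
- exists 0; apply: homogD => //; rewrite -(subrr (wt (lK i))) addrC.
  exact: homogM.
- exists (wt (lK i) + wt (lK j)); apply: homogD; first exact: homogM.
  by apply: homogN; rewrite addrC; apply: homogM.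
- exists (wt (lK i) + wt (lE j)); apply: homogD; first exact: homogM.
  by apply/homogN/homogZ; rewrite addrC; apply: homogM.
Qed.

Lemma relb_wE r : relb r -> exists m, homog wE m r.
Proof. by apply: relb_homog => i; rewrite /wE oppr0. Qed.

Lemma relb_wK r : relb r -> exists m, homog wK m r.
Proof. exact: relb_homog. Qed.

Local Notation projE := (proj wE).
Local Notation projK := (proj wK).

Lemma projE_wEK b v (x : F) : projE b (proj wEK v x) = projE b (projK (v - b) x).
Proof.
elim/falg_ind: x => [|c s x IHx]; first by rewrite !linear0.
rewrite !linearP /= IHx; congr (_ *: _ + _).
have wEKs : wtw wEK s = wtw wE s + wtw wK s by rewrite /wtw -big_split.
rewrite !proj_wd wEKs; have [e|ne] := eqVneq (wtw wE s) b.
  rewrite -{1}e [_ + wtw wK s]addrC -[wtw wK s == v - b]eq_sym subr_eq.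
  by rewrite -e [v == _]eq_sym; case: eqP; rewrite ?linear0.
by case: ifP => _; case: ifP => _; rewrite ?linear0 // proj_wd (negPf ne).
Qed.

Lemma epsb_ideal x : Id x -> epsb x = 0.
Proof.
apply: ideal_ker => r.
have eE i : epsb (gE i) = 0 by exact: fext_gn.
have eK i : epsb (gK i) = 1 by exact: fext_gn.
have eV i : epsb (gKi i) = 1 by exact: fext_gn.
case=> [[i [j [ij ->]]]|[[i ->]|[[i ->]|[[i [j ->]]|[i [j ->]]]]]].
- rewrite (serre_morph q A d epsb); apply: serre_eq0; first exact: (A_le0 cA).
  by left; apply: eE.
- by rewrite rmorphB rmorphM rmorph1 /= eK eV mulr1 subrr.
- by rewrite rmorphB rmorphM rmorph1 /= eK eV mulr1 subrr.
- by rewrite rmorphB !rmorphM /= !eK subrr.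
- by rewrite rmorphB /= linearZ /= !rmorphM /= !eE mulr0 mul0r scaler0 subrr.
Qed.

Definition lamb (v : 'rV[int]_n) (x : F) : K^o := epsb (projK v x).
Fact lamb_linear v : linear (lamb v).
Proof. by move=> a x y; rewrite /lamb !linearP. Qed.
HB.instance Definition _ v := GRing.isLinear.Build K F K^o *:%R (lamb v)
  (lamb_linear v).

Lemma lamb_ideal v x : Id x -> lamb v x = 0.
Proof. by move=> Ix; apply/epsb_ideal/(ideal_proj relb_wK). Qed.

Lemma lamb_eqI v x y : eqI relb x y -> lamb v x = lamb v y.
Proof. by move=> /(lamb_ideal v)/eqP; rewrite linearB subr_eq0 => /eqP. Qed.

Lemma lamb_bsM v u x :
  lamb v (bs F u * x) = epsb (bs F u) * lamb (v - wtw wK (fmonom_val u)) x.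
Proof. by rewrite /lamb bs_wd proj_mull rmorphM. Qed.

Lemma lamb1 v : lamb v 1 = (v == 0)%:R.
Proof.
rewrite /lamb -wd_nil proj_wd wtw_nil [v == 0]eq_sym wd_nil.
by case: eqP; rewrite ?rmorph1 ?linear0.
Qed.

(** The counit is multiplicative and the K-content additive, so a pure tensor on the left acts on
    the contraction by a scalar, a multiplication and a shift of [v]. This is the recursion behind
    [slicer_cop]. *)
Lemma slicer_tmu v u w t : slicer (lamb v) (tmu chi (pt T (u, w)) t) =
  epsb (bs F w) *: (bs F u * slicer (lamb (v - wtw wK (fmonom_val w))) t).
Proof.
elim/pt_ind: t => [|c [u' w'] t IHt]; first by rewrite !linear0 mulr0 linear0.
rewrite !linearP /= IHt mulrDr -scalerAr linearP /=; congr (_ *: _ + _).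
rewrite tmu_pt /chi_b scale1r /slicer !tlin_pt /= !bsM lamb_bsM.
by rewrite -scalerAr scalerA.
Qed.

Lemma slicel_tmu v u w t : slicel (lamb v) (tmu chi (pt T (u, w)) t) =
  epsb (bs F u) *: (bs F w * slicel (lamb (v - wtw wK (fmonom_val u))) t).
Proof.
elim/pt_ind: t => [|c [u' w'] t IHt]; first by rewrite !linear0 mulr0 linear0.
rewrite !linearP /= IHt mulrDr -scalerAr linearP /=; congr (_ *: _ + _).
rewrite tmu_pt /chi_b scale1r /slicel !tlin_pt /= !bsM lamb_bsM.
by rewrite -scalerAr scalerA.
Qed.

Lemma DbE l : Db l =
  match l with
  | inl (inl i) => pt T (fmu (lE i), @fmone bgen) + pt T (fmu (lK i), fmu (lE i))
  | _ => pt T (fmu l, fmu l)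
  end.
Proof. by case: l => [[i|i]|i]; rewrite /= -?bs1 !ten_bs. Qed.

Lemma epsb_gn l : epsb (gn F l) = if l is inl (inl _) then 0 else 1.
Proof. by rewrite /epsb fext_gn; case: l => [[]|]. Qed.

Lemma wtw_fmu (wt : bgen -> 'rV[int]_n) l : wtw wt (fmonom_val (fmu l)) = wt l.
Proof. by rewrite fmuE /= wtw_cons wtw_nil addr0. Qed.

Lemma wtw_fmone (wt : bgen -> 'rV[int]_n) : wtw wt (fmonom_val (@fmone bgen)) = 0.
Proof. by rewrite fmoneE /= wtw_nil. Qed.

Lemma proj_gnM (wt : bgen -> 'rV[int]_n) v l x :
  proj wt v (gn F l * x) = gn F l * proj wt (v - wt l) x.
Proof. by rewrite -wd_gen proj_mull wtw_cons wtw_nil addr0. Qed.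

(** The counit kills K_i (x) E_i. From each letter remains its term whose first factor is the letter
    itself and whose second factor carries its K-content. *)
Lemma slicer_cop v x : slicer (lamb v) (cop chi Db x) = projK v x.
Proof.
move: x; apply: linear_bs_ext => [||u]; try exact: linearP.
  by move=> a x y; rewrite !linearP.
rewrite bs_wd; elim: (fmonom_val u) v => [|l s IHs] v {u}.
  rewrite wd_nil cop1 /slicer /ton tlin_pt /= bs1 lamb1 -wd_nil proj_wd wtw_nil.
  by rewrite eq_sym; case: eqP; rewrite ?scale1r ?scale0r.
rewrite wd_cons cop_gnM DbE proj_gnM.
case: l => [[i|i]|i]; rewrite ?tmuDl ?linearD /= !slicer_tmu !wtw_fmu ?wtw_fmone
  !IHs -?/(gn F _) ?bs1 ?rmorph1 !epsb_gn ?scale0r ?addr0 !scale1r //=.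
Qed.

(** Now E_i (x) 1 is killed. From each letter remains the term with the letter as second factor; the
    first factor is K_i for E_i, so contents are counted by [wEK]. *)
Lemma slicel_cop v x : slicel (lamb v) (cop chi Db x) = proj wEK v x.
Proof.
move: x; apply: linear_bs_ext => [||u]; try exact: linearP.
  by move=> a x y; rewrite !linearP.
rewrite bs_wd; elim: (fmonom_val u) v => [|l s IHs] v {u}.
  rewrite wd_nil cop1 /slicel /ton tlin_pt /= bs1 lamb1 -wd_nil proj_wd wtw_nil.
  by rewrite eq_sym; case: eqP; rewrite ?scale1r ?scale0r.
rewrite wd_cons cop_gnM DbE proj_gnM /wEK.
case: l => [[i|i]|i]; rewrite ?tmuDl ?linearD /= !slicel_tmu !wtw_fmu ?wtw_fmone
  !IHs -?/(gn F _) ?bs1 ?rmorph1 !epsb_gn ?scale0r ?addr0 !scale1r //=.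
all: by rewrite !(subr0, addr0, oppr0, add0r).
Qed.

Lemma cop_gn l : cop chi Db (gn F l) = Db l.
Proof.
rewrite -[gn F l]mulr1 cop_gnM cop1; move: (Db l).
elim/pt_ind => [|c [u v] t IHt]; first by rewrite tmu0l.
by rewrite tmuDl tmuZl IHt /ton tmu_pt /chi_b scale1r /= !fmmulm1.
Qed.

(** * Group-like elements *)

Definition isK (l : bgen) : bool := if l is inl (inl _) then false else true.

(** The scalars [lamb v G] are orthogonal idempotents with sum [epsb G] = 1, so exactly one, at [m],
    is 1. Hence [G] has both K-content [m] and [wEK]-degree [m]; a component of weight b <> 0 would
    have K-content m - b, where [lamb] vanishes. *)
Lemma grouplike_form G : tideal relb (ten T G G - cop chi Db G) -> epsb G = 1 ->
  exists m, [/\ mhom wE relb 0 G, eqI relb G (projE 0 (projK m G)) &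
    forall v, lamb v G = (v == m)%:R].
Proof.
move=> tG eG.
have e1 v : eqI relb (lamb v G *: G) (projK v G).
  by have := tideal_slicer (@lamb_ideal v) tG; rewrite linearB /= slicer_ten slicer_cop.
have e2 v : eqI relb (lamb v G *: G) (proj wEK v G).
  by have := tideal_slicel (@lamb_ideal v) tG; rewrite linearB /= slicel_ten slicel_cop.
have gg v v' : lamb v G * lamb v' G = if v' == v then lamb v' G else 0.
  have := lamb_eqI v' (e1 v); rewrite linearZ /= -[_ *: _]/(_ * _) => ->.
  by rewrite /lamb proj_proj; case: eqP => // _; rewrite linear0.
have [m gm] : exists m, lamb m G != 0.
  apply: NNPP => none; case/eqP: (oner_neq0 K); rewrite -eG.
  have [ms [_ ->]] := proj_decomp wK G; rewrite linear_sum big1 // => m _.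
  by apply/eqP/negPn/negP => gm; apply: none; exists m.
have gm1 : lamb m G = 1 by apply: (mulfI gm); rewrite gg eqxx mulr1.
have gv v : lamb v G = (v == m)%:R.
  have [->//|vm] := eqVneq v m; apply: (mulfI gm).
  by rewrite gg (negPf vm) mulr0.
have G1 : eqI relb G (projK m G) by have := e1 m; rewrite gm1 scale1r.
have G2 : eqI relb G (proj wEK m G) by have := e2 m; rewrite gm1 scale1r.
have hG : mhom wE relb 0 G.
  apply: mhomW => b b0; apply/eqI0.
  rewrite (eqI_proj relb_wE b G2) projE_wEK -(eqI_proj relb_wE b (e1 _)) gv.
  rewrite [_ == m](_ : _ = false) ?scale0r ?linear0 //.
  by rewrite -subr_eq0 addrAC subrr add0r oppr_eq0 (negPf b0).
exists m; split=> //; apply: (eqI_trans hG); exact: eqI_proj relb_wE _ _ _ G1.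
Qed.

(** * Words in the letters K_i and their inverses *)

Lemma K_inv i : eqI relb (gK i * gKi i) 1.
Proof. by apply: ideal_gen; right; left; exists i. Qed.
Lemma Ki_inv i : eqI relb (gKi i * gK i) 1.
Proof. by apply: ideal_gen; do 2 right; left; exists i. Qed.
Lemma K_E i j : eqI relb (gK i * gE j) (q ^ bf (ew i) (ew j) *: (gE j * gK i)).
Proof. by apply: ideal_gen; do 4 right; exists i, j; rewrite bform_ew. Qed.

(** Multiply the hypothesis by the inverse [y'] on both sides. *)
Lemma qcomm_inv c x y y' : eqI relb (y * y') 1 -> eqI relb (y' * y) 1 ->
  eqI relb (x * y) (c *: (y * x)) -> eqI relb (y' * x) (c *: (x * y')).
Proof.
move=> yy' y'y xy; rewrite -[y' * x]mulr1 -yy' mulrA -[y' * x * y]mulrA xy.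
by rewrite -scalerAr -scalerAl mulrA y'y mul1r.
Qed.

Lemma qcomm1 x y y' : eqI relb (y * y') 1 -> eqI relb (y' * y) 1 ->
  eqI relb (x * y) (y * x) -> eqI relb (y' * x) (x * y').
Proof.
move=> yy' y'y xy; rewrite -[x * y']scale1r; apply: qcomm_inv yy' y'y _.
by rewrite scale1r.
Qed.

Lemma gnK_comm l l' : isK l -> isK l' ->
  eqI relb (gn F l * gn F l') (gn F l' * gn F l).
Proof.
have KK i j : eqI relb (gK i * gK j) (gK j * gK i).
  by apply: ideal_gen; do 3 right; left; exists i, j.
have VK i j : eqI relb (gKi i * gK j) (gK j * gKi i).
  exact: qcomm1 (K_inv i) (Ki_inv i) (KK j i).
case: l l' => [[//|i]|i] [[//|j]|j] _ _.
- exact: KK.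
- by apply: eqI_sym; apply: VK.
- exact: VK.
- apply: qcomm1 (K_inv i) (Ki_inv i) _; exact: VK.
Qed.

Lemma gnK_E l k : isK l -> exists c, eqI relb (gn F l * gE k) (c *: (gE k * gn F l)).
Proof.
case: l => [[//|i]|i] _; first by eexists; apply: K_E.
exists (q ^ bf (ew i) (ew k))^-1; apply: qcomm_inv (K_inv i) (Ki_inv i) _.
by rewrite K_E scalerA mulVf ?scale1r // expfz_neq0 // transcendental_neq0.
Qed.

Lemma wdK_comm s t : all isK s -> all isK t ->
  eqI relb (wd F s * wd F t) (wd F t * wd F s).
Proof.
move=> Ks Kt; elim: s Ks => [_|l s IHs /= /andP[Kl Ks]].
  by rewrite wd_nil mul1r mulr1; apply: eqI_refl.
rewrite wd_cons -mulrA IHs // !mulrA.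
suff -> : eqI relb (gn F l * wd F t) (wd F t * gn F l) by [].
elim: t Kt {IHs} => [_|l' t IHt /= /andP[Kl' Kt]].
  by rewrite wd_nil mul1r mulr1; apply: eqI_refl.
by rewrite wd_cons mulrA gnK_comm // -mulrA IHt // mulrA; apply: eqI_refl.
Qed.

Lemma wdK_E s k : all isK s ->
  exists c, eqI relb (wd F s * gE k) (c *: (gE k * wd F s)).
Proof.
elim: s => [_|l s IHs /= /andP[Kl Ks]].
  by exists 1; rewrite wd_nil mul1r mulr1 scale1r; apply: eqI_refl.
have [c hc] := IHs Ks; have [e he] := gnK_E k Kl; exists (c * e).
rewrite wd_cons -mulrA hc -scalerAr !mulrA he -scalerAl scalerA.
exact: eqI_refl.
Qed.

(** The inverse of the first letter is moved to the front of [s] and cancelled; the content stays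
    and the length drops. *)
Lemma wdK_cancel l l' s : isK l -> isK l' -> all isK s -> l' \in s ->
  eqI relb (gn F l * gn F l') 1 -> wK l + wK l' = 0 ->
  exists t, [/\ all isK t, wtw wK t = wtw wK (l :: s), (size t < size s)%N &
    eqI relb (wd F (l :: s)) (wd F t)].
Proof.
move=> Kl Kl' Ks /splitPr l's ll' w0; case: l's Ks => s1 s2.
rewrite all_cat /= => /andP[K1 /andP[_ K2]]; exists (s1 ++ s2); split.
- by rewrite all_cat K1 K2.
- by rewrite wtw_cons !wtw_cat wtw_cons [wtw wK s1 + (_ + _)]addrCA !addrA w0 add0r.
- by rewrite !size_cat /= addnS.
rewrite wd_cons !wd_cat wd_cons [wd F s1 * (_ * _)]mulrA.
have -> : eqI relb (wd F s1 * gn F l') (gn F l' * wd F s1).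
  by rewrite -wd_gen; apply: wdK_comm => //=; rewrite Kl'.
by rewrite !mulrA ll' mul1r; apply: eqI_refl.
Qed.

Lemma wK_coord l i : wK l 0 i = (l == lK i)%:R - (l == lKi i)%:R.
Proof.
case: l => [[j|j]|j].
- by rewrite /= mxE subrr.
- by rewrite /wK ewE subr0 eq_sym.
- by rewrite /wK mxE ewE sub0r eq_sym.
Qed.

(** Induction on the length. If the inverse of the first letter did not occur later, the coordinate
    of the content at its index would be nonzero; so it occurs and can be cancelled. *)
Lemma wdK_content0 s : all isK s -> wtw wK s = 0 -> eqI relb (wd F s) 1.
Proof.
have [m] := ubnP (size s); elim: m s => // m IHm [|l s] /=.
  by move=> _ _ _; rewrite wd_nil; apply: eqI_refl.
move=> ms /andP[Kl Ks] w0.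
have cancel l' : isK l' -> l' \in s -> eqI relb (gn F l * gn F l') 1 ->
    wK l + wK l' = 0 -> eqI relb (wd F (l :: s)) 1.
  move=> Kl' l's ll' wll'.
  have [t [Kt wt st ->]] := wdK_cancel Kl Kl' Ks l's ll' wll'.
  by apply: IHm; rewrite ?wt //; apply: ltn_trans st ms.
case: l Kl w0 cancel => [[//|i]|i] _ w0 cancel.
- have [Vs|nVs] := boolP (lKi i \in s).
    by apply: cancel Vs (K_inv i) _ => //; rewrite /= subrr.
  suff : 0 < wtw wK (lK i :: s) 0 i by rewrite w0 mxE ltxx.
  rewrite wtw_cons mxE wK_coord eqxx subr0 ltr_pwDl // /wtw summxE big_seq.
  apply: sumr_ge0 => l ls; rewrite wK_coord [l == lKi i](_ : _ = false).
    by rewrite subr0 ler0n.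
  by apply: contraNF nVs => /eqP <-.
- have [Vs|nVs] := boolP (lK i \in s).
    by apply: cancel Vs (Ki_inv i) _ => //; rewrite /= addNr.
  suff : 0 < - wtw wK (lKi i :: s) 0 i by rewrite w0 mxE oppr0 ltxx.
  rewrite wtw_cons mxE wK_coord eqxx sub0r opprD opprK ltr_pwDl // oppr_ge0.
  rewrite /wtw summxE big_seq; apply: sumr_le0 => l ls.
  rewrite wK_coord [l == lK i](_ : _ = false); first by rewrite sub0r oppr_le0 ler0n.
  by apply: contraNF nVs => /eqP <-.
Qed.

Lemma wE_ge0 s j : 0 <= wtw wE s 0 j.
Proof.
rewrite /wtw summxE sumr_ge0 // => -[[i|i]|i] _ /=; rewrite ?mxE //.
Qed.

Lemma wE0_isK s : wtw wE s = 0 -> all isK s.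
Proof.
elim: s => //= l s IHs; rewrite wtw_cons => e.
case: l e => [[i|i]|i] e /=; try by apply: IHs; rewrite -e add0r.
have := congr1 (fun z : 'rV[int]_n => z 0 i) e; rewrite mxE ewE eqxx [RHS]mxE.
move=> e1; suff : (0 : int) < 0 by rewrite ltxx.
by rewrite -{2}e1 ltr_pwDl ?wE_ge0.
Qed.

Lemma wE_ew_split s k : wtw wE s = ew k ->
  exists u v, [/\ s = u ++ lE k :: v, all isK u & all isK v].
Proof.
elim: s => [|l s IHs]; first by rewrite wtw_nil => /esym/eqP; rewrite (negPf (ew_neq0 k)).
rewrite wtw_cons; case: l => [[i|i]|i] /= e; last first.
- by have [|u [v [-> Ku Kv]]] := IHs; [rewrite -e add0r|exists (lKi i :: u), v].
- by have [|u [v [-> Ku Kv]]] := IHs; [rewrite -e add0r|exists (lK i :: u), v].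
have ik : i = k.
  have := congr1 (fun z : 'rV[int]_n => z 0 i) e; rewrite mxE !ewE eqxx.
  case: (i =P k) => // _ e1; suff : (0 : int) < 0 by rewrite ltxx.
  by rewrite -{2}[0](e1 : _ = 0) ltr_pwDl ?wE_ge0.
exists [::], s; split=> //; first by rewrite ik.
by apply: wE0_isK; apply: (addrI (ew k)); rewrite addr0 -{1}ik.
Qed.

(** A word without letters E and of content a_k has content 0 after multiplication by the inverse of
    K_k, so it equals K_k in the quotient. *)
Lemma proj_content_K k x : exists c, eqI relb (projE 0 (projK (ew k) x)) (c *: gK k).
Proof.
elim/falg_ind: x => [|c s x [e IHx]].
  by exists 0; rewrite !linear0 scale0r; apply: eqI_refl.
have [eE|nE] := eqVneq (wtw wE s) 0; last first.
  exists e; rewrite !linearP /= IHx proj_swap proj_wd (negPf nE) linear0 scaler0 add0r.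
  exact: eqI_refl.
have [eK|nK] := eqVneq (wtw wK s) (ew k); last first.
  exists e; rewrite !linearP /= IHx proj_wd (negPf nK) linear0 scaler0 add0r.
  exact: eqI_refl.
exists (c + e); rewrite !linearP /= IHx !proj_wd eK eqxx proj_wd eE eqxx scalerDl.
have Ks := wE0_isK eE.
have -> : eqI relb (wd F s) (gK k); last exact: eqI_refl.
have h : eqI relb (wd F s * gKi k) 1.
  rewrite -[gKi k]wd_gen -wd_cat; apply: wdK_content0; first by rewrite all_cat Ks.
  by rewrite wtw_cat eK wtw_cons wtw_nil addr0 /= subrr.
by rewrite -[wd F s]mulr1 -(Ki_inv k) mulrA h mul1r; apply: eqI_refl.
Qed.

(** Such a word has a single letter E, namely E_k. The letters before it move past it at the cost of
    a scalar, and the K-letters collected on the right have content 0. *)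
Lemma proj_content_E k x : exists c, eqI relb (projE (ew k) (projK 0 x)) (c *: gE k).
Proof.
elim/falg_ind: x => [|c s x [e IHx]].
  by exists 0; rewrite !linear0 scale0r; apply: eqI_refl.
have [eE|nE] := eqVneq (wtw wE s) (ew k); last first.
  exists e; rewrite !linearP /= IHx proj_swap proj_wd (negPf nE) linear0 scaler0 add0r.
  exact: eqI_refl.
have [eK|nK] := eqVneq (wtw wK s) 0; last first.
  exists e; rewrite !linearP /= IHx proj_wd (negPf nK) linear0 scaler0 add0r.
  exact: eqI_refl.
have [u [v [es Ku Kv]]] := wE_ew_split eE.
have [a ha] := wdK_E k Ku; exists (c * a + e).
rewrite !linearP /= IHx !proj_wd eK eqxx proj_wd eE eqxx scalerDl -scalerA.
have -> : eqI relb (wd F s) (a *: gE k); last exact: eqI_refl.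
rewrite es wd_cat wd_cons mulrA ha -scalerAl -mulrA -wd_cat wdK_content0.
- by rewrite mulr1; apply: eqI_refl.
- by rewrite all_cat Ku.
- by move: eK; rewrite es !wtw_cat wtw_cons add0r.
Qed.

(** Weight 0 leaves only words in the K-letters, which commute in the quotient. *)
Lemma proj0_comm x y :
  eqI relb (projE 0 x * projE 0 y) (projE 0 y * projE 0 x).
Proof.
elim/falg_ind: x => [|c s x IHx].
  by rewrite !linear0 mul0r mulr0; apply: eqI_refl.
rewrite !linearP /= mulrDl mulrDr IHx -scalerAl -scalerAr.
have -> : eqI relb (projE 0 (wd F s) * projE 0 y) (projE 0 y * projE 0 (wd F s));
  last exact: eqI_refl.
elim/falg_ind: y {IHx} => [|e t y IHy].
  by rewrite !linear0 mul0r mulr0; apply: eqI_refl.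
rewrite !linearP /= mulrDl mulrDr IHy -scalerAl -scalerAr !proj_wd.
case: eqP => [/wE0_isK Ks|_]; last by rewrite !mul0r !mulr0; apply: eqI_refl.
case: eqP => [/wE0_isK Kt|_]; last by rewrite !mul0r !mulr0; apply: eqI_refl.
by rewrite wdK_comm //; apply: eqI_refl.
Qed.

Lemma proj_homogMl m v (y x : F) : homog wE v y ->
  projE m (y * x) = y * projE (m - v) x.
Proof.
move=> <-; elim/falg_ind: y => [|c s y IHy]; first by rewrite !(linear0, mul0r).
rewrite linearP /= !mulrDl !linearD /= IHy -!scalerAl linearZ /= proj_wd.
by have [<-|_] := eqVneq; rewrite ?mul0r ?linear0 // proj_mull.
Qed.

Lemma proj_homogMr m v (y x : F) : homog wE v y ->
  projE m (x * y) = projE (m - v) x * y.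
Proof.
move=> <-; elim/falg_ind: y => [|c s y IHy]; first by rewrite !(linear0, mulr0).
rewrite linearP /= !mulrDr !linearD /= IHy -!scalerAr linearZ /= proj_wd.
by have [<-|_] := eqVneq; rewrite ?mulr0 ?linear0 // proj_mulr.
Qed.

(** * Two-dimensional representations detecting the E_k *)

Definition diag2 (a : K) : 'M[K]_2 :=
  \matrix_(i, j) if i == j then (if i == 0 then a else 1) else 0.

Lemma diag2M a b : diag2 a * diag2 b = diag2 (a * b).
Proof.
apply/matrixP => i j; rewrite mxE !big_ord_recl big_ord0 !mxE.
by case: i j => [[|[|//]] ?] [[|[|//]] ?];
  rewrite -?val_eqE /= ?(mulr0, mul0r, addr0, add0r, mulr1).
Qed.

Lemma diag2_1 : diag2 1 = 1.
Proof. by apply/matrixP => i j; rewrite !mxE if_same; case: eqP. Qed.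

Lemma diag2_E a : diag2 a * delta_mx 0 1 = a *: (delta_mx 0 1 * diag2 1).
Proof.
rewrite diag2_1 mulr1.
apply/matrixP => i j; rewrite mxE !big_ord_recl big_ord0 !mxE.
by case: i j => [[|[|//]] ?] [[|[|//]] ?];
  rewrite -?val_eqE /= ?(mulr0, mul0r, addr0, add0r, mulr1).
Qed.

Lemma E_diag2 a : delta_mx 0 1 * diag2 a = delta_mx 0 1 :> 'M[K]_2.
Proof.
apply/matrixP => i j; rewrite mxE !big_ord_recl big_ord0 !mxE.
by case: i j => [[|[|//]] ?] [[|[|//]] ?];
  rewrite -?val_eqE /= ?(mulr0, mul0r, addr0, add0r, mulr1).
Qed.

(** Here E_k is a nilpotent matrix unit and K_i is diagonal with entries q^(a_i, a_k) and 1, which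
    gives the required commutation with E_k; the other E_i act by 0. *)
Definition rep2 (k : 'I_n) (l : bgen) : 'M[K]_2 :=
  match l with
  | inl (inl i) => if i == k then delta_mx 0 1 else 0
  | inl (inr i) => diag2 (q ^ ((d i)%:Z * A i k))
  | inr i => diag2 (q ^ (- ((d i)%:Z * A i k)))
  end.

Lemma gE_nonideal k : ~ Id (gE k).
Proof.
have q0 := transcendental_neq0 q_tr.
suff rep0 x : relb x -> fext F (rep2 k) x = 0.
  move=> /(ideal_ker rep0) /=; rewrite /gE fext_gn /= eqxx => /matrixP/(_ 0 1).
  by rewrite !mxE /= => /eqP; rewrite oner_eq0.
have eE i : fext F (rep2 k) (gE i) = rep2 k (lE i) by exact: fext_gn.
have eK i : fext F (rep2 k) (gK i) = rep2 k (lK i) by exact: fext_gn.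
have eV i : fext F (rep2 k) (gKi i) = rep2 k (lKi i) by exact: fext_gn.
case=> [[i [j [ij ->]]]|[[i ->]|[[i ->]|[[i [j ->]]|[i [j ->]]]]]].
- rewrite serre_morph; apply: serre_eq0; first exact: (A_le0 cA).
  rewrite /= !eE /=; have [ik|] := eqVneq i k; last by left.
  by right; rewrite -ik eq_sym (negPf ij).
- rewrite rmorphB rmorphM rmorph1 /= eK eV /= diag2M -expfzDr // subrr.
  by rewrite expr0z diag2_1 subrr.
- rewrite rmorphB rmorphM rmorph1 /= eK eV /= diag2M -expfzDr // addNr.
  by rewrite expr0z diag2_1 subrr.
- by rewrite rmorphB !rmorphM /= !eK /= !diag2M mulrC subrr.
- rewrite rmorphB /= linearZ /= !rmorphM /= !eK !eE /=.
  have [->|_] := eqVneq j k; last by rewrite mulr0 mul0r scaler0 subrr.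
  by rewrite diag2_E !E_diag2 subrr.
Qed.

(** * The shape of an automorphism of [U_q(b^+)] *)

Section Form.
Variable f : F -> F.
Hypothesis fa : autb f.
Let f_auto : bialg_auto relb chi Db epsb f := fa.1.
Let fm : alg_mod relb f := bialg_auto_alg_mod f_auto.

Lemma autb_linear : linear f. Proof. by case: fm. Qed.
Lemma autb1 : eqI relb (f 1) 1. Proof. by case: fm. Qed.
Lemma autbM x y : eqI relb (f (x * y)) (f x * f y). Proof. by case: fm. Qed.

Lemma autb_cop x : tideal relb (tm T f f (cop chi Db x) - cop chi Db (f x)).
Proof. by case: f_auto => _ []. Qed.

Lemma autb_K l : isK l -> exists m, [/\ mhom wE relb 0 (f (gn F l)),
  eqI relb (f (gn F l)) (projE 0 (projK m (f (gn F l)))) &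
  forall v, lamb v (f (gn F l)) = (v == m)%:R].
Proof.
move=> Kl; apply: grouplike_form.
  have := autb_cop (gn F l); rewrite cop_gn.
  by case: l Kl => [[//|i]|i] _ /=; rewrite tm_ten //; exact: autb_linear.
by case: f_auto => _ [_ ->]; rewrite epsb_gn; case: l Kl => [[]|].
Qed.

Lemma autb_K_inv i : eqI relb (f (gK i) * f (gKi i)) 1.
Proof. by rewrite -autbM (alg_mod_eqI fm (K_inv i)) autb1; apply: eqI_refl. Qed.

(* For [x = f(E_i)] and [f(K_i) = K_m]: contracting
   [Delta x = x (x) 1 + f(K_i) (x) x] with the characters [lamb] on either side
   leaves only the weights [0] and [m]; weight [0] is then excluded by
   [K_i E_i = q^(2 d_i) E_i K_i]. *)
Lemma autb_E i m : (forall v, lamb v (f (gK i)) = (v == m)%:R) ->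
  mhom wE relb 0 (f (gK i)) ->
  mhom wE relb m (f (gE i)) /\
  eqI relb (f (gE i)) (projE m (projK 0 (f (gE i)))).
Proof.
move=> gv hG; have lf := autb_linear.
set x := f (gE i); set G := f (gK i).
have tx : tideal relb (ten T x (f 1) + ten T G x - cop chi Db x).
  have := autb_cop (gE i).
  by rewrite cop_gn /= linearD /= !tm_ten.
have e1 v : eqI relb ((v == 0)%:R *: x + lamb v x *: G) (projK v x).
  have := tideal_slicer (@lamb_ideal v) tx.
  by rewrite linearB linearD /= !slicer_ten slicer_cop /= (lamb_eqI v autb1) lamb1.
have e2 v : eqI relb (lamb v x *: f 1 + (v == m)%:R *: x) (proj wEK v x).
  have := tideal_slicel (@lamb_ideal v) tx.
  by rewrite linearB linearD /= !slicel_ten slicel_cop /= gv.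
have piG b : b != 0 -> eqI relb (projE b G) 0.
  by move=> b0; apply/eqI0; apply: (mhom_proj relb_wE hG).
have pi1 b : b != 0 -> eqI relb (projE b (f 1)) 0.
  move=> b0; apply/eqI0/(mhom_proj relb_wE _ b0)/(mhom_eqI relb_wE autb1).
  by apply: mhom_homog; rewrite /homog -wd_nil proj_wd wtw_nil eqxx.
have e1' b v : b != 0 -> eqI relb ((v == 0)%:R *: projE b x) (projE b (projK v x)).
  move=> b0; rewrite -(eqI_proj relb_wE b (e1 v)) linearD !linearZ /= piG //.
  by rewrite scaler0 addr0; apply: eqI_refl.
have e2' b v : b != 0 ->
    eqI relb ((v == m)%:R *: projE b x) (projE b (projK (v - b) x)).
  move=> b0; rewrite -projE_wEK -(eqI_proj relb_wE b (e2 v)) linearD !linearZ /=.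
  by rewrite pi1 // scaler0 add0r; apply: eqI_refl.
(* The right contraction identifies the component of weight [b] with its part of K-content 0; the
   left contraction at v = b says that this part vanishes, because b <> m. *)
have xb b : b != 0 -> b != m -> Id (projE b x).
  move=> b0 bm; apply/eqI0; have := e1' b 0 b0; rewrite eqxx scale1r => ->.
  have := e2' b b b0; rewrite subrr (negPf bm) scale0r => <-; exact: eqI_refl.
(* In weight 0 the transported relation compares G_0 x_0 with q^(2 d_i) x_0 G_0. These factors
   commute and q^(2 d_i) <> 1, so x_0 G_0 = 0; finally [G] equals G_0 in the quotient and is
   invertible there. *)
have x0 : Id (projE 0 x).
  have GV := autb_K_inv i; rewrite -/G in GV.
  have hG' : eqI relb G (projE 0 G) := hG.
  have comm : eqI relb (G * x) (q ^ bf (ew i) (ew i) *: (x * G)).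
    rewrite -!autbM -(linear_scale _ _ lf).
    exact: (alg_mod_eqI fm (K_E i i)).
  have : eqI relb (projE 0 G * projE 0 x)
      (q ^ bf (ew i) (ew i) *: (projE 0 x * projE 0 G)).
    have h0 : homog wE 0 (projE 0 G) by exact: homog_proj.
    have := eqI_proj relb_wE 0 comm; rewrite linearZ /=.
    have eL : eqI relb (projE 0 (G * x)) (projE 0 (projE 0 G * x)).
      by apply: eqI_proj relb_wE _ _ _ _; rewrite -hG'; apply: eqI_refl.
    have eR : eqI relb (projE 0 (x * G)) (projE 0 (x * projE 0 G)).
      by apply: eqI_proj relb_wE _ _ _ _; rewrite -hG'; apply: eqI_refl.
    by rewrite eL eR (proj_homogMl _ _ h0) (proj_homogMr _ _ h0) subr0.
  rewrite proj0_comm -[X in eqI _ X _]scale1r /eqI -scalerBl.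
  have nz : 1 - q ^ bf (ew i) (ew i) != 0.
    rewrite subr_eq0 -(expr0z q); apply/eqP => /(transcendental_expz_inj q_tr).
    rewrite bform_ew (A_diag cA) => /esym/eqP; rewrite mulf_eq0 orbF eqz_nat.
    by rewrite eqn0Ngt (d_gt0 dA).
  move=> /(idealZK nz) /eqI0; rewrite -hG' => xG; apply/eqI0.
  by rewrite -[projE 0 x]mulr1 -GV mulrA xG mul0r; apply: eqI_refl.
have hx : mhom wE relb m x.
  apply: (mhomW) => b bm; have [->//|b0] := eqVneq b 0; exact: xb.
split=> //; have hx' : eqI relb x (projE m x) := hx.
apply: (eqI_trans hx'); have [m0|m0] := eqVneq m 0; last first.
  by have := e1' m 0 m0; rewrite eqxx scale1r.
(* If m = 0, both sides are zero in the quotient, since [x] has no component of weight 0. *)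
rewrite m0; apply: (@eqI_trans _ _ _ _ 0); first by apply/eqI0.
apply: eqI_sym; rewrite proj_swap; apply/eqI0/(ideal_proj relb_wK); exact: x0.
Qed.

Lemma autb_form : exists alpha s,
  [/\ forall i, alpha i != 0, diagram_aut A s &
      forall l, eqI relb (f (gn F l)) (phib alpha s (gn F l))].
Proof.
have lf := autb_linear; have q_inj := transcendental_expz_inj q_tr.
have fnz i : ~ Id (f (gE i)).
  by move=> /(bialg_auto_ideal f_auto); apply: gE_nonideal.
have [m hm] : exists m : 'I_n -> 'rV[int]_n, forall i,
    [/\ eqI relb (f (gK i)) (projE 0 (projK (m i) (f (gK i)))),
        lamb (m i) (f (gK i)) = 1, mhom wE relb (m i) (f (gE i)),
        eqI relb (f (gE i)) (projE (m i) (projK 0 (f (gE i)))) &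
        forall j, 0 <= m i 0 j].
  apply: (fin_all_exists (P := fun i (m : 'rV[int]_n) =>
    [/\ eqI relb (f (gK i)) (projE 0 (projK m (f (gK i)))),
        lamb m (f (gK i)) = 1, mhom wE relb m (f (gE i)),
        eqI relb (f (gE i)) (projE m (projK 0 (f (gE i)))) &
        forall j, 0 <= m 0 j])) => i.
  have [m [hG eG gv]] := @autb_K (lK i) isT; exists m.
  have [hx ex] := autb_E gv hG; split=> //; first by rewrite gv eqxx.
  move=> j; have [|s <-] := @proj_neq0 _ _ _ _ wE m (f (gE i)).
    move=> p0; apply: (fnz i); apply/eqI0; rewrite -p0; exact: hx.
  exact: wE_ge0.
(* Images of K-letters have weight 0, so a simple root reached by [surj_weight] must come from the
   image of some E_i. *)
pose b (l : bgen) : 'rV[int]_n := if l is inl (inl i) then m i else 0.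
have hb l : mhom wE relb (b l) (f (gn F l)).
  case: l => [[i|i]|i] /=; first by case: (hm i).
    by have [? []] := @autb_K (lK i) isT.
  by have [? []] := @autb_K (lKi i) isT.
have b0 l j : 0 <= b l 0 j.
  by case: l => [[i|i]|i] /=; rewrite ?mxE //; case: (hm i).
have [s hs] : exists s : {perm 'I_n}, forall i, m i = ew (s i).
  apply: ew_perm => k; have [z fz] := bialg_auto_surj (gE k) f_auto.
  have hE : homog wE (ew k) (gE k) by exact: (homog_gen F wE (lE k)).
  have [w hw] := surj_weight relb_wE fm hb hE (@gE_nonideal k) fz.
  have [[[i|i]|i] _ bl] := sum_eq_ew b0 hw; first by exists i.
    by have := ew_neq0 k; rewrite -bl eqxx.
  by have := ew_neq0 k; rewrite -bl eqxx.
have [a ha] : exists a : 'I_n -> K, forall i,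
    eqI relb (f (gE i)) (a i *: gE (s i)).
  apply: (fin_all_exists (P := fun i (c : K) =>
    eqI relb (f (gE i)) (c *: gE (s i)))) => i.
  have [c hc] := proj_content_E (s i) (f (gE i)).
  exists c; apply: eqI_trans hc; rewrite -hs; by case: (hm i).
have hK i : eqI relb (f (gK i)) (gK (s i)).
  have [c hc] := proj_content_K (s i) (f (gK i)).
  have [eG g1 _ _ _] := hm i; rewrite hs in eG g1.
  have {}hc := eqI_trans eG hc.
  (* The scalar is found by applying [lamb] at content a_(s i), which takes the value 1 on both
     f(K_i) and K_(s i). *)
  have := lamb_eqI (ew (s i)) hc; rewrite g1 linearZ /=.
  have -> : lamb (ew (s i)) (gK (s i)) = 1.
    rewrite /lamb /gK -wd_gen proj_wd wtw_cons wtw_nil addr0 /= eqxx wd_gen.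
    exact: epsb_gn.
  by rewrite -[_ *: _]/(c * 1) mulr1 => c1; move: hc; rewrite -c1 scale1r.
have hV i : eqI relb (f (gKi i)) (gKi (s i)).
  have := autb_K_inv i; rewrite hK => h.
  by rewrite -[f (gKi i)]mul1r -(Ki_inv (s i)) -mulrA h mulr1; apply: eqI_refl.
have a0 i : a i != 0.
  apply/eqP => ai; apply: (fnz i); apply/eqI0; rewrite (ha i) ai scale0r.
  exact: eqI_refl.
exists (fun k => a (s^-1%g k)), s; split=> [i||].
- exact: a0.
- apply: (bform_diagram cA dA) => i j; apply: q_inj.
  (* The image of K_i E_j = q^(a_i, a_j) E_j K_i makes a multiple of E_(s j) K_(s i) vanish. That
     product is nonzero because K_(s i) is invertible, so the two powers of [q] agree. *)
  have := alg_mod_eqI fm (K_E i j); rewrite (linear_scale _ _ lf) !autbM.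
  rewrite hK ha -scalerAl -scalerAr K_E /eqI !scalerA -scalerBl mulrC -mulrBl.
  move=> rel; apply/eqP; rewrite -subr_eq0; apply/negP => /negP nz.
  apply: (@gE_nonideal (s j)); apply/eqI0.
  have /eqI0 EK := idealZK (mulf_neq0 nz (a0 j)) rel.
  rewrite -[gE (s j)]mulr1 -(K_inv (s i)) mulrA EK mul0r; exact: eqI_refl.
- case=> [[i|i]|i]; rewrite /phib fext_gn; [|exact: hK|exact: hV].
  by rewrite permK; apply: ha.
Qed.
End Form.

(** * Torus and diagram automorphisms of [U_q(b^+)] *)

Definition cb (alpha : 'I_n -> K) (s : {perm 'I_n}) (l : bgen) : K :=
  if l is inl (inl i) then alpha (s i) else 1.
Definition pb (s : {perm 'I_n}) (l : bgen) : bgen :=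
  match l with
  | inl (inl i) => lE (s i) | inl (inr i) => lK (s i) | inr i => lKi (s i)
  end.

Lemma phibE alpha s x : phib alpha s x = mono F (cb alpha s) (pb s) x.
Proof.
apply: (@lrmorph_falg_ext _ _ _ F (fext F _) (mono F (cb alpha s) (pb s))) => l.
by rewrite /= mono_gn fext_gn; case: l => [[i|i]|i] //=; rewrite scale1r.
Qed.

Lemma relb_mono alpha (s : {perm 'I_n}) x : diagram_aut A s ->
  relb x -> Id (mono F (cb alpha s) (pb s) x).
Proof.
move=> As; have ds k : d (s k) = d k := diagram_aut_sym cA dA k As.
have eE i : mono F (cb alpha s) (pb s) (gE i) = alpha (s i) *: gE (s i) by exact: mono_gn.
have eK i : mono F (cb alpha s) (pb s) (gK i) = gK (s i) by rewrite [LHS]mono_gn scale1r.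
have eV i : mono F (cb alpha s) (pb s) (gKi i) = gKi (s i) by rewrite [LHS]mono_gn scale1r.
case=> [[i [j [ij ->]]]|[[i ->]|[[i ->]|[[i [j ->]]|[i [j ->]]]]]].
- rewrite serre_morph.
  have -> : serre q A d (fun k => mono F (cb alpha s) (pb s) (gE k)) i j =
      serre q A d (fun k => alpha (s k) *: gE (s k)) i j.
    by apply: eq_bigr => v _; rewrite !eE.
  have [e ->] := serre_scale q gE (fun k => alpha (s k)) i j As ds.
  apply/idealZ/ideal_gen; left; exists (s i), (s j).
  by rewrite (inj_eq perm_inj).
- rewrite rmorphB rmorphM rmorph1 /= eK eV; exact: K_inv.
- rewrite rmorphB rmorphM rmorph1 /= eK eV; exact: Ki_inv.
- rewrite rmorphB !rmorphM /= !eK; apply: ideal_gen; do 3 right; left.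
  by exists (s i), (s j).
- rewrite rmorphB /= linearZ /= !rmorphM /= eK eE -scalerAl -scalerAr.
  rewrite scalerA mulrC -scalerA -scalerBr; apply/idealZ/ideal_gen.
  by do 4 right; exists (s i), (s j); rewrite As ds.
Qed.

Lemma Sb_wd_cons l s : Sb (wd F (l :: s)) = Sb (wd F s) * Sb (gn F l).
Proof.
by rewrite -wd_gen /Sb !lin_bs /= rev_cons big_rcons /= rev_cons big_rcons big_nil /= mul1r.
Qed.

Lemma Sb_linear : linear Sb. Proof. exact: linearP. Qed.

(** Both composites reverse products, so it suffices to compare them on letters; the equality holds
    already in the free algebra. *)
Lemma phib_Sb alpha s x : Sb (phib alpha s x) = phib alpha s (Sb x).
Proof.
rewrite !phibE; move: x; apply: linear_bs_ext => [a x y|a x y|u].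
- by rewrite linearP Sb_linear.
- by rewrite Sb_linear linearP.
rewrite bs_wd; elim: (fmonom_val u) => [|l w IHw].
  by rewrite wd_nil rmorph1 -wd_nil /Sb lin_bs /= big_nil rmorph1.
rewrite Sb_wd_cons rmorphM /= -IHw mono_wd /= wd_cons big_cons.
rewrite !(linear_scale _ _ Sb_linear) -wd_cons Sb_wd_cons mono_wd.
rewrite (linear_scale _ _ Sb_linear) -scalerAl mulrC -scalerA; congr (_ *: _).
rewrite scalerAr; congr (_ * _).
rewrite /Sb -!wd_gen !lin_bs /= !big_seq1.
case: l => [[i|i]|i]; rewrite /= ?scale1r ?linearN ?rmorphM /= !mono_gn /=
  ?scale1r // -scalerAr //.
Qed.

Lemma pb_perm s : cancel (pb s) (pb s^-1%g).
Proof. by case=> [[i|i]|i] /=; rewrite permK. Qed.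

(** Transports the automorphism property from the monomial form to [phib], which agrees with it
    pointwise by [phibE]. *)
Lemma bialg_auto_ext P c D e (f g : F -> F) : f =1 g ->
  bialg_auto (T := T) P c D e f -> bialg_auto (T := T) P c D e g.
Proof.
move=> fg [[lf If [h [lh Ih hf fh]] fM f1] [fD fe]].
have tmE t : tm T g g t = tm T f f t.
  by move: t; apply: linear_pt_ext => [||p]; try exact: linearP;
    rewrite /tm !tlin_pt !fg.
split; [split|split].
- by move=> a x y; rewrite -!fg lf.
- by move=> x /If; rewrite fg.
- by exists h; split=> // x; rewrite -fg.
- by move=> x y; rewrite -!fg.
- by rewrite -fg.
- by move=> x; rewrite tmE -fg.
- by move=> x; rewrite -fg.
Qed.

Lemma phib_aut alpha s : (forall i, alpha i != 0) -> diagram_aut A s ->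
  autb (phib alpha s).
Proof.
move=> a0 As; split; last by move=> x; rewrite phib_Sb subrr; apply: ideal0.
apply: (bialg_auto_ext (fun x => esym (phibE alpha s x))).
apply: (@mono_bialg_auto _ _ _ _ _ _ _ _ _ _
  (cb (fun i => (alpha (s i))^-1) s^-1%g) (pb s^-1%g)).
- by case=> [[i|i]|i] /=; rewrite ?mulr1 // permKV mulfV.
- by case=> [[i|i]|i] /=; rewrite ?mulr1 // permKV mulVf.
- exact: pb_perm.
- by move=> l; have := pb_perm s^-1%g l; rewrite invgK.
- by move=> x; apply: relb_mono.
- by move=> x; apply/relb_mono/diagram_autV.
- by [].
- have e l : mono F (cb alpha s) (pb s) (gn F l) = cb alpha s l *: gn F (pb s l).
    exact: mono_gn.
  case=> [[i|i]|i]; rewrite /= ?linearD /= !tm_ten ?rmorph1 ?e /=; try exact: linearP.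
  + by rewrite scale1r tenZl linearZ /= -scalerDr.
  + by rewrite !scale1r.
  + by rewrite !scale1r.
- apply: (@lrmorph_falg_ext _ _ F K^o (epsb \o mono F _ _) epsb) => l /=.
  rewrite mono_gn linearZ /= !epsb_gn.
  by case: l => [[i|i]|i]; rewrite /= -[_ *: _]/(_ * _) ?mulr0 ?mulr1.
Qed.

Theorem autb_torus_diag : torus_diag_iso A autb (eqI relb) phib.
Proof.
split.
- by move=> alpha s [a0 As]; apply: phib_aut.
- move=> f fa; have [alpha [s [a0 As hf]]] := autb_form fa.
  exists alpha, s; split=> //; apply: alg_mod_ext => //.
  + exact: bialg_auto_alg_mod fa.1.
  + exact: bialg_auto_alg_mod (phib_aut a0 As).1.
- move=> alpha s beta t [a0 _] [b0 _] e.
  have gE_proj k l : projE (ew k) (gE l) = (l == k)%:R *: gE l.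
    rewrite /gE -wd_gen proj_wd wtw_cons wtw_nil addr0 /= (inj_eq (@ew_inj n)).
    by case: eqP; rewrite ?scale1r ?scale0r.
  (* Compare components of weight a_(s i): if t i <> s i, a nonzero multiple of E_(s i) would lie in
     the ideal; otherwise the scalars agree because E_(t i) is nonzero. *)
  have est i : s i = t i /\ alpha (s i) = beta (t i).
    have := eqI_proj relb_wE (ew (s i)) (e (gE i)).
    rewrite /phib !fext_gn /= !linearZ /= !gE_proj eqxx scale1r.
    have [<-|_] := eqVneq (t i) (s i).
      rewrite scale1r /eqI -scalerBl => rel; split=> //; apply/eqP.
      rewrite -subr_eq0; apply/negP => /negP nz.
      by case: (@gE_nonideal (t i)); apply: idealZK nz rel.
    rewrite scale0r scaler0 => /eqI0 rel.
    by case: (@gE_nonideal (s i)); apply: idealZK (a0 _) rel.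
  have st : s = t by apply/permP => i; case: (est i).
  split=> // k; have [_] := est (s^-1%g k).
  by rewrite -st permKV.
- move=> alpha s beta t _ _ x; rewrite !phibE mono_comp.
  rewrite (@mono_eq _ _ _ _ _ (cb (fun k => alpha k * beta ((s^-1)%g k)) (t * s)%g)
    (pb (t * s)%g)) //.
  + by case=> [[i|i]|i] /=; rewrite ?mulr1 // permM permK mulrC.
  + by case=> [[i|i]|i] /=; rewrite permM.
Qed.

End Borel.

(** * The concrete free algebra *)

Section Malg.
Variables (K : fieldType) (T : choiceType).

Lemma malg_ind (Q : {malg K[T]} -> Prop) :
  Q 0 -> (forall c u x, Q x -> Q (c *: << u >> + x)) -> forall x, Q x.
Proof.
move=> Q0 QD x; rewrite [x]monalgE.
elim: (enum_fset _) => [|u s IHs]; first by rewrite big_nil.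
rewrite big_cons; have -> : << x@_u *g u >> = x@_u *: << u >> :> {malg K[T]}.
  by apply/malgP=> k; rewrite mcoeffZ !mcoeffU mulr_natr.
exact: QD.
Qed.

Lemma malgUZ (c : K) (u : T) : << c *g u >> = c *: << u >> :> {malg K[T]}.
Proof. by apply/malgP=> k; rewrite mcoeffZ !mcoeffU mulr_natr. Qed.

Variable V : lmodType K.

(** The common form of [lext] and [tlext], convertible with both. *)
Definition mlext (h : T -> V) (x : {malg K[T]}) : V :=
  \sum_(u <- msupp x) x@_u *: h u.

(** Sums over different supports become comparable on a common larger set, as linearity requires. *)
Lemma mlextEw (h : T -> V) (D : {fset T}) x :
  (msupp x `<=` D)%fset -> mlext h x = \sum_(u <- D) x@_u *: h u.
Proof.
move=> sxD; rewrite /mlext (big_fset_incl _ sxD) // => u _ /mcoeff_outdom ->.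
by rewrite scale0r.
Qed.

Lemma mlext_linear (h : T -> V) : linear (mlext h).
Proof.
move=> a x y; pose D := (msupp x `|` msupp y `|` msupp (a *: x + y))%fset.
rewrite !(@mlextEw _ D) ?scaler_sumr -?big_split /=.
- by apply: eq_bigr => u _; rewrite mcoeffD mcoeffZ scalerDl scalerA.
- by rewrite /D -fsetUA fsetUCA fsubsetUl.
- by rewrite /D -fsetUA fsubsetUl.
- by rewrite /D fsubsetUr.
Qed.

Lemma mlextU h u : mlext h << u >> = h u.
Proof.
rewrite /mlext msuppU oner_eq0 (big_seq_fset1 _ u).
by rewrite mcoeffUU scale1r.
Qed.
End Malg.

Lemma mlext2_linear (K : fieldType) (S T : choiceType) (V : lmodType K)
    (h : S -> T -> V) (x : {malg K[S]}) :
  linear (fun y : {malg K[T]} => mlext (fun u => mlext (h u) y) x).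
Proof.
move=> a y z; rewrite /mlext scaler_sumr -big_split /=; apply: eq_bigr => u _.
rewrite -![\sum_(v <- _) _]/(mlext (h u) _) mlext_linear scalerDr !scalerA.
by rewrite mulrC.
Qed.

Section FreeAlgebra.
Variables (K : fieldType) (I : choiceType).
Local Notation W := {fmonom I}.

Lemma falg_scalerAr (c : K) (x y : FAlg K I) : c *: (x * y) = x * (c *: y).
Proof.
apply: (iffLR (malgP _ _)) => k; apply: (eq_trans (mcoeffZ c (x * y) k)); rewrite (mcoeffMl x y k).
rewrite (mcoeffMlw k (fsubset_refl (msupp x)) (msuppZ_le c y)).
rewrite big_distrr; apply: eq_bigr => u _; rewrite big_distrr.
by apply: eq_bigr => v _; rewrite mcoeffZ /= mulrnAr mulrCA.
Qed.

(* The library's [algType] structure on [malg] requires commuting monomials. *)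
Definition falg_alg : algType K :=
  HB.pack (FAlg K I) (GRing.Lalgebra_isAlgebra.Build K (FAlg K I) falg_scalerAr).

Lemma falg_bs1 : << @fmone I >> = 1 :> falg_alg.
Proof. by []. Qed.

Lemma falg_bsM (u v : W) : << fmmul u v >> = << u >> * << v >> :> falg_alg.
Proof.
by apply: esym; apply: (eq_trans (@fgmulUU _ K 1 1 u v)); rewrite mulr1.
Qed.

Definition falg_free : free_alg K I :=
  @FreeAlg K I falg_alg (fun u => << u >>) falg_bs1 falg_bsM
    (@malg_ind K W) (fun V h => @mlext K W V h) (fun V h => mlext_linear h)
    (fun V h u => mlextU h u).

(** Written as an iterated linear extension, [tens] gets its bilinearity from [mlext_linear]. *)
Lemma tensE (x y : FAlg K I) :
  tens x y = mlext (fun u => mlext (fun v => << (u, v) >> : TAlg K I) y) x.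
Proof.
rewrite /tens /mlext; apply: eq_bigr => u _; rewrite scaler_sumr.
by apply: eq_bigr => v _; rewrite malgUZ scalerA.
Qed.

Lemma tmulE chi (x y : TAlg K I) : tmul chi x y =
  mlext (fun p => mlext (fun p' =>
    chi p.2 p'.1 *: << (fmmul p.1 p'.1, fmmul p.2 p'.2) >> : TAlg K I) y) x.
Proof.
rewrite /tmul /mlext; apply: eq_bigr => p _; rewrite scaler_sumr.
by apply: eq_bigr => p' _; rewrite malgUZ !scalerA.
Qed.

Lemma tens_linl (y : FAlg K I) : linear (fun x => tens x y).
Proof. by move=> a x z; rewrite !tensE mlext_linear. Qed.
Lemma tens_linr (x : FAlg K I) : linear (tens x).
Proof.
move=> a y z; rewrite !tensE.
exact: (mlext2_linear (fun u v => << (u, v) >> : TAlg K I) x a y z).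
Qed.
Lemma tensUU (u v : W) : tens << u >> << v >> = << (u, v) >> :> TAlg K I.
Proof. by rewrite tensE !mlextU. Qed.
Lemma tmul_linl chi (y : TAlg K I) : linear (fun x => tmul chi x y).
Proof. by move=> a x z; rewrite !tmulE mlext_linear. Qed.
Lemma tmul_linr chi (x : TAlg K I) : linear (tmul chi x).
Proof.
move=> a y z; rewrite !tmulE.
exact: (mlext2_linear (fun p p' => chi p.2 p'.1 *:
  << (fmmul p.1 p'.1, fmmul p.2 p'.2) >> : TAlg K I) x a y z).
Qed.
Lemma tmulUU chi (p p' : W * W) : tmul chi << p >> << p' >> =
  chi p.2 p'.1 *: << (fmmul p.1 p'.1, fmmul p.2 p'.2) >> :> TAlg K I.
Proof. by rewrite tmulE !mlextU. Qed.

Definition talg_sq : tens_sq falg_free :=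
  @TensSq K I falg_free (TAlg K I) (fun p => << p >>)
    (@malg_ind K (W * W)%type)
    (fun c p => << c *g p >>) (fun c p => malgUZ c p)
    (fun V h => @mlext K (W * W)%type V h) (fun V h => mlext_linear h)
    (fun V h p => mlextU h p) (@tens K I) tens_linl tens_linr tensUU
    (@tmul K I) tmul_linl tmul_linr tmulUU.

End FreeAlgebra.

(** * Transfer to the concrete algebras *)

Theorem theorem1p7 (K : fieldType) (q : K) (n : nat) (A : 'M[int]_n)
    (d : 'I_n -> nat) :
  [pchar K] =i pred0 ->
  transcendental_over_Q q ->
  simple_cartan_matrix A ->
  normalized_symmetrizer A d ->
  torus_diag_iso A (HopfAut_Uplus q A d) (eq_mod_plus q A d) (phi_plus (n:=n))
  /\ torus_diag_iso A (HopfAut_Ub q A d) (eq_mod_b q A d) (phi_b (n:=n)).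
Proof.
move=> _ q_tr cA dA; split; last first.
  (* At [falg_free] and [talg_sq] the abstract notions unfold to those of the statement, so the
     abstract theorem applies by conversion. *)
  exact: (@autb_torus_diag K q n A d (falg_free K _) (talg_sq K _) q_tr cA dA).
have eps_linear : linear (@eps_plus K n : FAlg K 'I_n -> K^o).
  by move=> a x y; rewrite /eps_plus mcoeffD mcoeffZ.
have eps_wd s : eps_plus (wd (falg_free K 'I_n) s) = (s == [::])%:R.
  rewrite /eps_plus /wd /= mcoeffU fmoneE.
  by rewrite -[FMonom s == _]/(s == [::]).
exact: (@autp_torus_diag K q n A d (falg_free K _) (talg_sq K _) q_tr cA dA
  _ eps_linear eps_wd).
Qed.
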